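(* Let $M$ be an $n_1\times n_2$ matrix of rank $r$ obeying assumptions A0 and A1 (with parameters $\mu_0>0$ and $\mu_1\ge 1$), and put $n=\max(n_1,n_2)$. Suppose we observe the $m$ entries of $M$ indexed by a set $\Omega$ of cardinality $m$ sampled uniformly at random. Then there exist numerical constants $C,c$ such that if $$m\ge C\max\big(\mu_1^2,\ \mu_0^{1/2}\mu_1,\ \mu_0 n^{1/4}\big)\,n\,r\,(\beta\log n)$$ for some $\beta>2$, then the minimizer of $$\text{minimize } \|X\|_* \quad\text{subject to } X_{ij}=M_{ij},\ (i,j)\in\Omega$$ is unique and equal to $M$ with probability at least $1-c\,n^{-\beta}$. For $r\le \mu_0^{-1}n^{1/5}$, the same conclusion holds, with the same probability, under the condition $$m\ge C\,\mu_0\,n^{6/5}\,r\,(\beta\log n).$$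
   Context: $\|X\|_*$ is the nuclear norm. Let $M=\sum_{k=1}^r\sigma_ku_kv_k^*$ be the SVD of $M$ ($\sigma_k>0$, $\{u_k\}$ orthonormal in $\mathbb{R}^{n_1}$, $\{v_k\}$ orthonormal in $\mathbb{R}^{n_2}$), and let $U=\mathrm{span}(u_1,\dots,u_r)$, $V=\mathrm{span}(v_1,\dots,v_r)$ be the column and row spaces. Coherence: for a subspace $W\subseteq\mathbb{R}^d$ of dimension $r$ with orthogonal projection $P_W$, $\mu(W)=\frac{d}{r}\max_{1\le i\le d}\|P_We_i\|^2$, where $(e_i)$ is the standard basis of $\mathbb{R}^d$. Assumption A0: $\max(\mu(U),\mu(V))\le\mu_0$. Assumption A1: every entry of the $n_1\times n_2$ matrix $\sum_{k=1}^ru_kv_k^*$ is bounded in absolute value by $\mu_1\sqrt{r/(n_1n_2)}$. *)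

(* Defs.v *)
From mathcomp Require Import all_boot.
From Stdlib Require Import Reals ClassicalEpsilon.
Set Implicit Arguments. Unset Strict Implicit. Unset Printing Implicit Defensive.

Definition asbool (P : Prop) : bool :=
  if excluded_middle_informative P then true else false.

Definition vec (d : nat) := 'I_d -> R.
Definition mat (n1 n2 : nat) := 'I_n1 -> 'I_n2 -> R.

Definition dot (d : nat) (x y : vec d) : R :=
  \big[Rplus/0%R]_(i < d) (x i * y i)%R.

Definition sqnorm (d : nat) (x : vec d) : R := dot x x.

Definition orthonormal (d r : nat) (w : 'I_r -> vec d) : Prop :=
  forall k l : 'I_r, dot (w k) (w l) = (if k == l then 1 else 0)%R.

Definition ebasis (d : nat) (i : 'I_d) : vec d :=
  fun j => if j == i then 1%R else 0%R.

(* Orthogonal projection onto W = span(w_0..w_{r-1}), w orthonormal: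
   P_W x = sum_k <w_k, x> w_k. *)
Definition proj (d r : nat) (w : 'I_r -> vec d) (x : vec d) : vec d :=
  fun j => \big[Rplus/0%R]_(k < r) (dot (w k) x * w k j)%R.

(* Coherence mu(W) = (d/r) max_i ||P_W e_i||^2, W given by an orthonormal
   basis w of size r. *)
Definition coherence (d r : nat) (w : 'I_r -> vec d) : R :=
  (INR d / INR r * \big[Rmax/0%R]_(i < d) sqnorm (proj w (ebasis i)))%R.

Definition svd_mat (n1 n2 r : nat) (s : 'I_r -> R)
  (a : 'I_r -> vec n1) (b : 'I_r -> vec n2) : mat n1 n2 :=
  fun i j => \big[Rplus/0%R]_(k < r) (s k * a k i * b k j)%R.

Definition is_svd (n1 n2 : nat) (X : mat n1 n2) (r : nat) (s : 'I_r -> R)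
  (a : 'I_r -> vec n1) (b : 'I_r -> vec n2) : Prop :=
  (forall k, 0 < s k)%R /\ orthonormal a /\ orthonormal b /\
  (forall i j, X i j = svd_mat s a b i j).

Definition nuclear_norm_is (n1 n2 : nat) (X : mat n1 n2) (t : R) : Prop :=
  exists (r : nat) (s : 'I_r -> R) (a : 'I_r -> vec n1) (b : 'I_r -> vec n2),
    is_svd X s a b /\ t = \big[Rplus/0%R]_(k < r) s k.

Definition unique_nuc_minimizer (n1 n2 : nat) (Omega : {set 'I_n1 * 'I_n2})
  (M : mat n1 n2) : Prop :=
  forall X : mat n1 n2,
    (forall i j, (i, j) \in Omega -> X i j = M i j) ->
    (exists i j, X i j <> M i j) ->
    forall tX tM, nuclear_norm_is X tX -> nuclear_norm_is M tM -> (tM < tX)%R.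

Definition prob_unif_subset (n1 n2 m : nat)
  (P : {set 'I_n1 * 'I_n2} -> Prop) : R :=
  (INR #|[set Om : {set 'I_n1 * 'I_n2} | (#|Om| == m) && asbool (P Om)]|
     / INR 'C(n1 * n2, m))%R.

(* Main.v *)
(* Golfing with geometric slack.  Let T be the tangent space at M and R the operator that samples q
   entries with replacement, rescaled so that E R = Id.  A batch maps W in T to P_T (W - R W), and
   Chernoff's inequality, entry by entry, shows that it shrinks the sup norm by n^(-1/10) because
   m exceeds mu0 n r beta log n by a factor n^(1/5). After 160 batches, a constant number, the residual is
   polynomially small.  Starting from U V^T, the sum Y of the sampled matrices R W is an approximate
   dual certificate; starting from every P_T (e_i e_j^T), the same argument shows that a matrix
   vanishing on the sample is controlled by its component orthogonal to T.

   The component of Y orthogonal to T has small norm because || R W - W || is small for fixed W.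
   This follows from a moment bound on tr S^(2p), p of order beta log n, S a sum of independent
   centred Hermitian dilations of single entries.  Exchanging one summand with an independent copy
   gives tr S^(2p) <= C p tr (V S^(2p-2)) in expectation; V is diagonal, with entries that are row
   and column counts, and scalar exponential moments finish the bound.

   Assumption A1 controls the sup norm of U V^T in the first regime.  In the second one the bound
   mu0 r / sqrt (n1 n2) given by Cauchy-Schwarz suffices. *)
From Stdlib Require Import Reals.
From mathcomp Require Import all_boot all_order all_algebra.
From mathcomp Require Import boolp Rstruct ring lra zify.
Require Import Defs.
Set Implicit Arguments. Unset Strict Implicit. Unset Printing Implicit Defensive.
Import Order.TTheory GRing.Theory Num.Theory.
Local Open Scope ring_scope.
(* The delimiter [%R] goes back to [R_scope] for the final theorem. *)
Delimit Scope R_scope with coqR.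
Bind Scope ring_scope with R.

(** * Trace inequalities *)

(** A constant number of batches is what keeps the logarithm to the first power: every batch pays
    [beta log n], and the Chernoff exponent is quadratic in the contraction factor, so a slack of
    [n^(1/5)] buys exactly a contraction by [n^(-1/10)]. Both regimes have this slack, since
    [n^(1/4) >= n^(1/5)] in one and [m] is of order [n^(6/5)] in the other. Contraction is claimed
    for fixed matrices only, so each starting point and each entry costs a union bound; these powers
    of [n] are paid by [n^2 <= exp (beta log n)], that is, by [beta > 2]. No exact certificate is
    built, and none that serves all competitors at once. For each nonzero [Z] vanishing on the
    sample, a subgradient [Q] of the nuclear norm at [M] with positive inner product with [Z] is
    enough, and adding a small multiple of [PTp Z] outweighs the residual left on the tangent space.
    Nothing is diagonalized: spectra are seen only through traces of powers and through log-convex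
    sequences of quadratic moments. *)

Section TracePowers.
Variable R : realFieldType.

Lemma mxtrace_gram_ge0 m n (A : 'M[R]_(m, n)) : 0 <= \tr (A^T *m A).
Proof.
apply: sumr_ge0 => i _; rewrite mxE; apply: sumr_ge0 => j _.
by rewrite mxE -expr2 sqr_ge0.
Qed.

Lemma mxtrace_gram_AMGM m n (A B : 'M[R]_(m, n)) :
  2 * \tr (A^T *m B) <= \tr (A^T *m A) + \tr (B^T *m B).
Proof.
have := mxtrace_gram_ge0 (A - B).
rewrite [(A - B)^T]linearB /= mulmxBl !mulmxBr !linearB /= -[\tr (B^T *m A)]mxtrace_tr.
by rewrite trmx_mul trmxK; lra.
Qed.

Lemma trmx_exp_sym d (S : 'M[R]_d) (Ssym : S^T = S) k : (S ^+ k)^T = S ^+ k.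
Proof.
elim: k => [|k IH]; first by rewrite expr0; apply: trmx1.
by rewrite {1}exprSr trmx_mul IH Ssym mulmxE -exprS.
Qed.

Lemma CauchySchwarz_sum (I : finType) (x y : I -> R) :
  (\sum_i x i * y i) ^+ 2 <= (\sum_i x i ^+ 2) * (\sum_i y i ^+ 2).
Proof.
set a := \sum_i x i ^+ 2; set b := \sum_i _ * _; set c := \sum_i y i ^+ 2.
have H t : 0 <= a - 2 * t * b + t ^+ 2 * c.
  have -> : a - 2 * t * b + t ^+ 2 * c = \sum_i (x i - t * y i) ^+ 2.
    rewrite /a /b /c !mulr_sumr -sumrB -big_split /=.
    by apply: eq_bigr => i _; ring.
  by apply: sumr_ge0 => i _; apply: sqr_ge0.
have a0 : 0 <= a by apply: sumr_ge0 => i _; apply: sqr_ge0.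
have c0 : 0 <= c by apply: sumr_ge0 => i _; apply: sqr_ge0.
have [c_eq0|cN0] := eqVneq c 0.
  suff -> : b = 0 by rewrite expr0n mulr_ge0.
  apply/eqP/negPn/negP => bN0.
  have := H ((a + 1) / (2 * b)); rewrite c_eq0 mulr0 addr0.
  have -> : a - 2 * ((a + 1) / (2 * b)) * b = -1 by field.
  by rewrite oppr_ge0 ler10.
have cgt0 : 0 < c by rewrite lt0r cN0.
have := H (b / c).
have -> : a - 2 * (b / c) * b + (b / c) ^+ 2 * c = (a * c - b ^+ 2) / c by field.
by rewrite pmulr_lge0 ?invr_gt0// subr_ge0.
Qed.

(** Convexity puts [g a] below the chord from [0] to [a.+1] ([slope]), hence below the larger of
    [g a.+1] and [g 0]. Walking to the right end leaves the maximum of the two endpoints, and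
    nonnegativity turns it into their sum. *)
Lemma convex_seq_le (g : nat -> R) r :
  (forall a, (a.+2 <= r)%N -> 2 * g a.+1 <= g a + g a.+2) ->
  (forall a, (a <= r)%N -> 0 <= g a) ->
  forall a, (a <= r)%N -> g a <= g 0%N + g r.
Proof.
move=> cvx g0.
have slope a : (a < r)%N -> a.+1%:R * g a <= a%:R * g a.+1 + g 0%N.
  elim: a => [|a IH] lt_ar; first by rewrite mul0r mul1r add0r.
  have := IH (ltnW lt_ar); have := cvx a lt_ar.
  have : (0 : R) <= a%:R by [].
  rewrite -!natr1; move: (a%:R) (g a) (g a.+1) (g a.+2) (g 0%N) => x u v w z.
  nra.
have step a : (a < r)%N -> g a <= Num.max (g a.+1) (g 0%N).
  move=> ltar; rewrite -(@ler_pM2l _ a.+1%:R) ?ltr0n//.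
  apply: le_trans (slope a ltar) _.
  rewrite -natr1 mulrDl mul1r lerD ?ler_wpM2l ?le_max ?lexx ?orbT//.
move=> a le_ar; apply: (@le_trans _ _ (Num.max (g r) (g 0%N))); last first.
  by rewrite ge_max lerDl lerDr !g0.
rewrite -(subKn le_ar); elim: (r - a)%N (leq_subr a r) => [|k IH] le_kr.
  by rewrite subn0 le_max lexx.
have lt : (r - k.+1 < r)%N by rewrite ltn_subrL (leq_ltn_trans _ le_kr).
apply: le_trans (step _ lt) _; rewrite -subSn // subSS ge_max IH ?(ltnW le_kr)//.
by rewrite le_max lexx orbT.
Qed.

(* [X a] is chosen so that [<X a, X c> = tr (H A^(a+c) H B^(2r-a-c))]: the even-index values are
   squared norms, and Cauchy-Schwarz makes them a convex sequence. *)
Lemma mxtrace_mixed_power d (H A B : 'M[R]_d) r j : (j <= r.*2)%N ->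
  H^T = H -> A^T = A -> B^T = B ->
  \tr (H * A ^+ j * H * B ^+ (r.*2 - j)) <=
  \tr (H ^+ 2 * A ^+ r.*2) + \tr (H ^+ 2 * B ^+ r.*2).
Proof.
move=> le_j Hs As Bs.
pose X a := A ^+ a * H * B ^+ (r - a).
have XX a c : (a <= r)%N -> (c <= r)%N ->
    \tr ((X a)^T *m X c) = \tr (H * A ^+ (a + c) * H * B ^+ (r.*2 - (a + c))).
  move=> ar cr; rewrite /X !trmx_mul !trmx_exp_sym// Hs mxtrace_mulC -!mulmxE.
  have -> : (r.*2 - (a + c) = (r - c) + (r - a))%N by rewrite -addnn; lia.
  rewrite !exprD -!mulmxE mxtrace_mulC -!mulmxA mxtrace_mulC.
  by rewrite -!mulmxA.
pose g a := \tr ((X a)^T *m X a).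
have g_ge0 a : (a <= r)%N -> 0 <= g a by move=> _; apply: mxtrace_gram_ge0.
have cvx a : (a.+2 <= r)%N -> 2 * g a.+1 <= g a + g a.+2.
  move=> ar; have := mxtrace_gram_AMGM (X a) (X a.+2).
  by rewrite XX ?(ltnW (ltnW ar))// /g XX ?(ltnW ar)// addSn addnS -addSn -addSnnS addSnnS.
have gle := convex_seq_le cvx g_ge0.
have -> : \tr (H ^+ 2 * A ^+ r.*2) + \tr (H ^+ 2 * B ^+ r.*2) = g 0%N + g r.
  have -> : g 0%N = \tr (H ^+ 2 * B ^+ r.*2) by rewrite /g XX// subn0 expr0 mulr1 expr2.
  have -> : g r = \tr (H ^+ 2 * A ^+ r.*2).
    rewrite /g XX// addnn subnn expr0 mulr1 expr2 -!mulmxE mxtrace_mulC.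
    by rewrite !mulmxA.
  by rewrite addrC.
have jE : (j = j./2 + uphalf j)%N by rewrite uphalf_half addnCA addnn odd_double_half.
have h1 : (j./2 <= r)%N by rewrite -(doubleK r) half_leq.
have h2 : (uphalf j <= r)%N by rewrite leq_uphalf_double.
have := mxtrace_gram_AMGM (X j./2) (X (uphalf j)).
rewrite XX// -jE -/(g _) -/(g _); have := gle _ h1; have := gle _ h2; lra.
Qed.

(** Noncommutative mean value inequality: the difference of powers telescopes into terms
    [A^j (A - B) B^(2r-j)], each controlled by [mxtrace_mixed_power]. *)
Lemma mxtrace_pow_diff d (A B : 'M[R]_d) r : A^T = A -> B^T = B ->
  \tr ((A - B) * (A ^+ r.*2.+1 - B ^+ r.*2.+1)) <=
  r.*2.+1%:R * (\tr ((A - B) ^+ 2 * A ^+ r.*2) + \tr ((A - B) ^+ 2 * B ^+ r.*2)).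
Proof.
move=> As Bs; set H := A - B.
have Hs : H^T = H by rewrite /H linearB /= As Bs.
have telescope m : A ^+ m - B ^+ m = \sum_(j < m) A ^+ j * H * B ^+ (m.-1 - j).
  elim: m => [|m IH]; first by rewrite big_ord0 subrr.
  rewrite big_ord_recr /= subnn expr0 mulr1.
  have -> : \sum_(i < m) A ^+ i * H * B ^+ (m - i) = (A ^+ m - B ^+ m) * B.
    rewrite IH mulr_suml; apply: eq_bigr => i _; rewrite -[RHS]mulrA -exprSr.
    by case: m {IH} i => [[]//|m] i /=; rewrite subSn// -ltnS.
  by rewrite /H mulrBr mulrBl -!exprSr addrC subrKA.
rewrite telescope mulr_sumr linear_sum /= -[r.*2.+1 in leRHS]card_ord mulr_natl -sumr_const.
apply: ler_sum => j _; rewrite !mulrA; apply: mxtrace_mixed_power => //.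
by rewrite -ltnS.
Qed.

(** Lyapunov's inequality without roots: [m k ^ (1/k)] is nondecreasing. *)
Lemma logconvex_pow (m : nat -> R) : m 0%N = 1 -> (forall k, 0 <= m k) ->
  (forall k, m k.+1 ^+ 2 <= m k * m k.+2) ->
  forall k, m k ^+ k.+1 <= m k.+1 ^+ k.
Proof.
move=> m0 mge0 mlc; elim=> [|k IH]; first by rewrite m0 expr1 expr0.
have [->|mN0] := eqVneq (m k.+1) 0; first by rewrite expr0n exprn_ge0.
have mgt0 : 0 < m k.+1 by rewrite lt0r mN0 mge0.
rewrite -(@ler_pM2l _ (m k.+1 ^+ k)) ?exprn_gt0//.
have H : (m k.+1 ^+ 2) ^+ k.+1 <= (m k * m k.+2) ^+ k.+1.
  by rewrite ler_pXn2r// nnegrE ?exprn_ge0 ?mulr_ge0.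
rewrite -exprD; have -> : (k + k.+2 = 2 * k.+1)%N by lia.
rewrite exprM (le_trans H)// exprMn ler_wpM2r ?exprn_ge0//.
Qed.

Lemma logconvex_pow1 (m : nat -> R) : m 0%N = 1 -> (forall k, 0 <= m k) ->
  (forall k, m k.+1 ^+ 2 <= m k * m k.+2) ->
  forall k, m 1%N ^+ k <= m k.
Proof.
move=> m0 mge0 mlc; elim=> [|k IH]; first by rewrite m0 expr0.
case: k IH => [|k] IH; first by rewrite expr1.
rewrite -(@ler_pXn2r _ k.+1) ?nnegrE ?exprn_ge0//.
apply: le_trans (logconvex_pow m0 mge0 mlc k.+1).
by rewrite -exprM mulnC exprM ler_pXn2r ?nnegrE ?exprn_ge0.
Qed.

(** If the first term does not already dominate, then [eta g < V b]; inserted in the hypothesis,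
    this gives [b eta^p <= V^p], so the second term dominates. *)
Lemma young_pow (V b g eta : R) p : 0 <= V -> 0 <= b -> 0 <= g -> 0 < eta ->
  b ^+ p.+1 <= g ^+ p -> V * b <= eta * g + V ^+ p.+1 / eta ^+ p.
Proof.
move=> V0 b0 g0 e0 bg.
have t0 : 0 <= V ^+ p.+1 / eta ^+ p by rewrite divr_ge0 ?exprn_ge0// ltW.
have [le|lt] := lerP (V * b) (eta * g); first by rewrite -[leLHS]addr0 lerD.
have bgt0 : 0 < b.
  by rewrite lt0r b0 andbT; apply: contraTneq lt => ->; rewrite mulr0 -leNgt mulr_ge0// ltW.
apply: le_trans (_ : V ^+ p.+1 / eta ^+ p <= _); last by rewrite lerDr mulr_ge0// ltW.
rewrite ler_pdivlMr ?exprn_gt0// exprS -mulrA ler_wpM2l//.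
rewrite -(@ler_pM2r _ (b ^+ p)) ?exprn_gt0// mulrAC -exprS -exprMn mulrC.
apply: le_trans (_ : eta ^+ p * g ^+ p <= _); first by rewrite ler_wpM2l ?exprn_ge0// ltW.
by rewrite -exprMn lerXn2r ?nnegrE ?mulr_ge0 ?(ltW lt) ?(ltW e0).
Qed.

End TracePowers.

(** * Sampling with and without replacement *)

Section Expectation.
Variables (R : realFieldType) (T : finType).
Implicit Types (phi psi : seq T -> R).

Definition avg (g : T -> R) : R := (\sum_a g a) / #|T|%:R.

(** Iterated averages instead of a sum over tuples: conditioning on a first batch is then a plain
    induction ([Ex_cat]). *)
Fixpoint Ex (q : nat) phi : R :=
  if q is q'.+1 then avg (fun a => Ex q' (fun s => phi (a :: s))) else phi [::].

Lemma eq_avg (g h : T -> R) : g =1 h -> avg g = avg h.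
Proof. by move=> gh; rewrite /avg (eq_bigr h). Qed.

Lemma le_avg (g h : T -> R) : (forall a, g a <= h a) -> avg g <= avg h.
Proof. by move=> gh; rewrite /avg ler_wpM2r ?invr_ge0 ?ler_sum. Qed.

Lemma avgD (g h : T -> R) : avg (fun a => g a + h a) = avg g + avg h.
Proof. by rewrite /avg big_split mulrDl. Qed.

Lemma avgZ c (g : T -> R) : avg (fun a => c * g a) = c * avg g.
Proof. by rewrite /avg -mulr_sumr mulrA. Qed.

Lemma avg_sum (I : finType) (g : I -> T -> R) :
  avg (fun a => \sum_i g i a) = \sum_i avg (g i).
Proof. by rewrite /avg exchange_big mulr_suml. Qed.

Lemma avg_swap (g : T -> T -> R) :
  avg (fun a => avg (fun b => g a b)) = avg (fun b => avg (fun a => g a b)).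
Proof. by rewrite /avg -!mulr_suml exchange_big. Qed.

Lemma eq_Ex q phi psi : (forall s, size s = q -> phi s = psi s) -> Ex q phi = Ex q psi.
Proof.
elim: q phi psi => [|q IH] phi psi e /=; first exact: e.
by apply: eq_avg => a; apply: IH => s sq; apply: e; rewrite /= sq.
Qed.

Lemma le_Ex q phi psi : (forall s, size s = q -> phi s <= psi s) -> Ex q phi <= Ex q psi.
Proof.
elim: q phi psi => [|q IH] phi psi e /=; first exact: e.
by apply: le_avg => a; apply: IH => s sq; apply: e; rewrite /= sq.
Qed.

Lemma ExD q phi psi : Ex q (fun s => phi s + psi s) = Ex q phi + Ex q psi.
Proof.
elim: q phi psi => [|q IH] phi psi //=.
by rewrite -avgD; apply: eq_avg => a; rewrite IH.
Qed.

Lemma ExZ q c phi : Ex q (fun s => c * phi s) = c * Ex q phi.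
Proof.
elim: q phi => [|q IH] phi //=.
by rewrite -avgZ; apply: eq_avg => a; rewrite IH.
Qed.

Lemma Ex_sum q (I : finType) (phi : I -> seq T -> R) :
  Ex q (fun s => \sum_i phi i s) = \sum_i Ex q (phi i).
Proof.
elim: q phi => [|q IH] phi //=.
by rewrite -avg_sum; apply: eq_avg => a; rewrite IH.
Qed.

Lemma Ex_avg q (phi : T -> seq T -> R) :
  Ex q (fun s => avg (fun a => phi a s)) = avg (fun a => Ex q (phi a)).
Proof.
elim: q phi => [|q IH] phi //=.
by rewrite avg_swap; apply: eq_avg => a; rewrite IH.
Qed.

Lemma Ex_cat q1 q2 phi :
  Ex (q1 + q2) phi = Ex q1 (fun s1 => Ex q2 (fun s2 => phi (s1 ++ s2))).
Proof.
elim: q1 phi => [|q1 IH] phi //=.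
by apply: eq_avg => a; rewrite IH.
Qed.

Hypothesis T_gt0 : (0 < #|T|)%N.

Lemma avg_cst (c : R) : avg (fun=> c) = c.
Proof. by rewrite /avg sumr_const -[c *+ _]mulr_natr mulfK// pnatr_eq0 -lt0n. Qed.

Lemma Ex_cst q (c : R) : Ex q (fun=> c) = c.
Proof. by elim: q => //= q IH; rewrite IH avg_cst. Qed.

Lemma Ex_prod q (g : T -> R) : Ex q (fun s => \prod_(a <- s) g a) = avg g ^+ q.
Proof.
elim: q => [|q IH] /=; first by rewrite big_nil.
rewrite exprS -IH mulrC -avgZ; apply: eq_avg => a.
by rewrite mulrC -ExZ; apply: eq_Ex => s _; rewrite big_cons.
Qed.

Lemma ExS q phi : Ex q.+1 phi = avg (fun a => Ex q (fun s => phi (a :: s))).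
Proof. by []. Qed.

Arguments Ex : simpl never.

(* Isolating one draw: the other draws enter only through the additive statistic [Y]. *)
Lemma Ex_sum_rest (V : zmodType) (Y : T -> V) (psi : T -> V -> R) q :
  Ex q.+1 (fun s => \sum_(a <- s) psi a (\sum_(b <- s) Y b - Y a)) =
  q.+1%:R * avg (fun a => Ex q (fun s => psi a (\sum_(b <- s) Y b))).
Proof.
(* The offset [c] absorbs the draws already fixed, so that the induction can peel off the first
   one. *)
suff gen q' c : Ex q'.+1 (fun s => \sum_(a <- s) psi a (c + \sum_(b <- s) Y b - Y a)) =
  q'.+1%:R * avg (fun a => Ex q' (fun s => psi a (c + \sum_(b <- s) Y b))).
  transitivity (Ex q.+1 (fun s => \sum_(a <- s) psi a (0 + \sum_(b <- s) Y b - Y a))).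
    by apply: eq_Ex => s _; rewrite add0r.
  by rewrite gen; congr (_ * _); apply: eq_avg => a; apply: eq_Ex => s _; rewrite add0r.
elim: q' c => [|q' IH] c.
  rewrite mul1r ExS; apply: eq_avg => a; rewrite /Ex.
  by rewrite !big_seq1 big_nil addrK addr0.
rewrite [LHS]ExS -natr1 mulrDl mul1r addrC.
transitivity (avg (fun a => Ex q'.+1 (fun s => psi a (c + \sum_(b <- s) Y b))) +
   avg (fun a => Ex q'.+1 (fun s =>
     \sum_(b <- s) psi b ((c + Y a) + \sum_(b <- s) Y b - Y b)))).
  rewrite -avgD; apply: eq_avg => a; rewrite -ExD; apply: eq_Ex => s _.
  rewrite !big_cons; congr (psi _ _ + _).
    by rewrite [Y a + _]addrC addrA addrK.
  by apply: eq_bigr => b _; rewrite addrA.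
congr (_ + _).
rewrite (eq_avg (fun a => IH (c + Y a))) avgZ avg_swap; congr (_ * _).
apply: eq_avg => b; rewrite ExS; apply: eq_avg => a; apply: eq_Ex => s _.
by rewrite big_cons addrA.
Qed.

End Expectation.

Section UniformSubset.
Variables (R : realFieldType) (T : finType).
Implicit Types phi : {set T} -> R.

Definition antitone phi := forall S S' : {set T}, S \subset S' -> phi S' <= phi S.

Definition subset_avg (k : nat) phi : R := (\sum_(S : {set T} | #|S| == k) phi S) / 'C(#|T|, k)%:R.

Lemma le_subset_avg k phi psi : (forall S, phi S <= psi S) ->
  subset_avg k phi <= subset_avg k psi.
Proof. by move=> h; rewrite /subset_avg ler_wpM2r ?invr_ge0// ler_sum. Qed.

(* Both sides count the pairs [(S', a)] with [a] in [S'] and [#|S'| = k + 1]. *)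
Lemma sum_add_element k phi :
  \sum_(S : {set T} | #|S| == k) \sum_(a | a \notin S) phi (a |: S) =
  k.+1%:R * \sum_(S : {set T} | #|S| == k.+1) phi S.
Proof.
rewrite (exchange_big_dep predT)//= mulr_sumr.
transitivity (\sum_a \sum_(S : {set T} | (#|S| == k.+1) && (a \in S)) phi S).
  apply: eq_bigr => a _.
  rewrite [RHS](reindex_onto (fun S => a |: S) (fun S => S :\ a)) /=; last first.
    by move=> S /andP[_ aS]; rewrite setD1K.
  apply: eq_bigl => S; rewrite setU11 andbT cardsU1.
  have [aS|aS] := boolP (a \in S); last by rewrite setU1K// eqxx andbT.
  rewrite andbF; apply/esym/andP => -[_ /eqP /setP /(_ a)].
  by rewrite !inE eqxx aS.
rewrite (exchange_big_dep (fun S : {set T} => #|S| == k.+1))/=; last by move=> a S _ /andP[].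
apply: eq_bigr => S /eqP cS; rewrite cS eqxx /=.
by rewrite sumr_const mulr_natl cS.
Qed.

(** A uniform element added to a uniform [k]-subset either is new, which gives a uniform subset of
    size [k.+1], or is already present and leaves the subset smaller, where an antitone [phi] is
    larger on average. *)
Lemma subset_avg_step k phi : antitone phi -> (k < #|T|)%N ->
  subset_avg k.+1 phi <= subset_avg k (fun S => avg (fun a => phi (a |: S))).
Proof.
move=> anti lt_k; rewrite /subset_avg /avg -mulr_suml.
set A := \sum_(S : {set T} | #|S| == k) phi S.
pose D := \sum_(S : {set T} | #|S| == k) \sum_(a | a \notin S) phi (a |: S).
have -> : \sum_(S : {set T} | #|S| == k) \sum_a phi (a |: S) = k%:R * A + D.
  rewrite /A mulr_sumr -big_split /=; apply: eq_bigr => S /eqP cS.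
  rewrite (bigID [pred a | a \in S]) /=; congr (_ + _).
  rewrite (eq_bigr (fun=> phi S)) ?sumr_const ?cS ?mulr_natl// => a aS.
  by congr phi; apply/setUidPr; rewrite sub1set.
have DB := sum_add_element k phi; rewrite -/D in DB.
have DA : D <= (#|T| - k)%:R * A.
  rewrite /A mulr_sumr; apply: ler_sum => S /eqP cS.
  apply: le_trans (_ : \sum_(a | a \notin S) phi S <= _).
    by apply: ler_sum => a _; apply: anti; apply: subsetUr.
  have cE : #|[pred a | a \notin S]| = (#|T| - k)%N.
    by rewrite -cS -[in RHS](setCK S) -cardsCs; apply: eq_card => x; rewrite !inE.
  by rewrite sumr_const cE [leRHS]mulr_natl.
set N := #|T| in lt_k DA *.
have C0 : (0 : R) < 'C(N, k)%:R by rewrite ltr0n bin_gt0 ltnW.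
have CE : 'C(N, k.+1)%:R = (N - k)%:R * 'C(N, k)%:R / k.+1%:R :> R.
  by rewrite -natrM -mul_bin_left natrM mulrAC mulfV ?mul1r// pnatr_eq0.
have N0 : (0 : R) < N%:R by rewrite ltr0n (leq_ltn_trans _ lt_k).
have Nk0 : (0 : R) < (N - k)%:R by rewrite ltr0n subn_gt0.
have NE : N%:R = k%:R + (N - k)%:R :> R by rewrite -natrD subnKC// ltnW.
set B := \sum_(S : {set T} | #|S| == k.+1) phi S in DB *.
have -> : B / 'C(N, k.+1)%:R = D / (N - k)%:R / 'C(N, k)%:R.
  rewrite CE DB; move: Nk0 C0 => /gt_eqF h1 /gt_eqF h2.
  by field; rewrite h1 h2 addrC natr1 pnatr_eq0.
rewrite ler_pM2r ?invr_gt0// ler_pdivrMr// mulrAC ler_pdivlMr// NE.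
have := ler_wpM2l (ler0n R k) DA; move: ((N - k)%:R) => e; lra.
Qed.

(** Hybrid scheme for the induction: [k] elements without replacement followed by [j] draws with
    replacement. *)
Lemma subset_avg_le_Ex_gen (j k : nat) phi : antitone phi -> (k + j <= #|T|)%N ->
  subset_avg (k + j) phi <=
  subset_avg k (fun S => Ex j (fun s => phi (S :|: [set x in s]))).
Proof.
move=> anti; elim: j k => [|j IH] k le_kj.
  rewrite addn0; apply: le_subset_avg => S; rewrite /Ex.
  have -> : [set x in [::] : seq T] = set0 by apply/setP => x; rewrite !inE.
  by rewrite setU0.
rewrite -addSnnS; apply: le_trans (IH k.+1 _) _; first by rewrite addSnnS.
apply: le_trans (subset_avg_step _ _) _.
- move=> S S' SS'; apply: le_Ex => s _; apply: anti; exact: setSU.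
- by apply: leq_trans le_kj; rewrite -addSnnS leq_addr.
apply: le_subset_avg => S; rewrite ExS; apply: le_avg => a; apply: le_Ex => s _.
by rewrite set_cons setUCA setUA setUC setUA.
Qed.

(* Drawing with replacement gives at most [m] distinct elements, so it is the worse scheme for an
   antitone failure indicator. *)
Lemma subset_avg_le_Ex m phi : antitone phi -> (m <= #|T|)%N ->
  subset_avg m phi <= Ex m (fun s => phi [set x in s]).
Proof.
move=> anti le_m; apply: le_trans (subset_avg_le_Ex_gen anti (k := 0) le_m) _.
rewrite /subset_avg bin0 divr1 (big_pred1 set0); last by move=> S; rewrite /= cards_eq0.
by apply: le_Ex => s _; rewrite set0U.
Qed.

End UniformSubset.

(** * Moments of a sum of random matrices *)

Section QuadraticMoments.
Variables (R : realFieldType) (d : nat) (S : 'M[R]_d) (z : 'cV[R]_d).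
Hypothesis Ssym : S^T = S.

(** After division by [quad 0], the moments of the spectral measure of [S] at [z]. *)
Definition quad (k : nat) : R := (z^T *m S ^+ k *m z) 0 0.

Lemma quadD a b : quad (a + b) = \sum_i (S ^+ a *m z) i 0 * (S ^+ b *m z) i 0.
Proof.
rewrite /quad exprD -mulmxE !mulmxA -[z^T *m S ^+ a]trmxK trmx_mul (trmx_exp_sym Ssym) trmxK.
by rewrite -mulmxA mxE; apply: eq_bigr => i _; rewrite mxE.
Qed.

Lemma quad_double_ge0 k : 0 <= quad k.*2.
Proof. by rewrite -addnn quadD; apply: sumr_ge0 => i _; rewrite -expr2 sqr_ge0. Qed.

Lemma quad_CauchySchwarz a b : quad (a + b) ^+ 2 <= quad a.*2 * quad b.*2.
Proof.
rewrite -!addnn !quadD; apply: le_trans (CauchySchwarz_sum _ _) _.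
by under eq_bigr do rewrite expr2; under [in X in _ * X]eq_bigr do rewrite expr2.
Qed.

Lemma quad_logconvex k : quad k.+1.*2 ^+ 2 <= quad k.*2 * quad k.+2.*2.
Proof.
have -> : k.+1.*2 = (k + k.+2)%N by rewrite -addnn; lia.
exact: quad_CauchySchwarz.
Qed.

Lemma quad_le_mxtrace k : quad k.*2 <= quad 0 * \tr (S ^+ k.*2).
Proof.
have -> : quad 0 = \sum_j z j 0 ^+ 2.
  by rewrite (quadD 0 0) expr0; apply: eq_bigr => i _; rewrite mul1mx expr2.
have -> : \tr (S ^+ k.*2) = \sum_i \sum_j (S ^+ k) i j ^+ 2.
  rewrite -addnn exprD; apply: eq_bigr => i _; rewrite -[X in _ * X](trmx_exp_sym Ssym).
  by rewrite mxE; apply: eq_bigr => j _; rewrite mxE expr2.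
rewrite -addnn quadD mulrC mulr_suml; apply: ler_sum => i _.
by rewrite -expr2 mxE; apply: CauchySchwarz_sum.
Qed.

(** The normalized even moments are log-convex, so the [k]-th power of the first one is at most the
    [k]-th one, hence at most the trace. Cauchy-Schwarz then passes from [S ^+ 2] to [S]. *)
Lemma quad1_le_of_mxtrace k (t : R) : (0 < k)%N -> 0 <= t ->
  \tr (S ^+ k.*2) <= t ^+ k.*2 -> quad 1 <= t * quad 0.
Proof.
move=> k0 t0 le_t.
have q0 : 0 <= quad 0 by rewrite -[0%N]/(0.*2) quad_double_ge0.
have [q0E|q0N] := eqVneq (quad 0) 0.
  have := quad_CauchySchwarz 0 1; rewrite q0E mul0r mulr0 => h.
  have /eqP : quad 1 ^+ 2 = 0 by apply/eqP; rewrite eq_le h sqr_ge0.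
  by rewrite expf_eq0 /= => /eqP ->.
have qgt0 : 0 < quad 0 by rewrite lt0r q0N.
pose m k := quad k.*2 / quad 0.
have m0 : m 0%N = 1 by rewrite /m mulfV.
have mge0 j : 0 <= m j by rewrite /m divr_ge0 ?quad_double_ge0.
have mlc j : m j.+1 ^+ 2 <= m j * m j.+2.
  rewrite /m expr_div_n mulrACA -invfM -expr2 ler_pM2r ?invr_gt0 ?exprn_gt0//.
  exact: quad_logconvex.
have h1 : m 1%N ^+ k <= (t ^+ 2) ^+ k.
  apply: le_trans (logconvex_pow1 m0 mge0 mlc k) _.
  rewrite -exprM mul2n /m ler_pdivrMr// mulrC; apply: le_trans (quad_le_mxtrace k) _.
  by rewrite ler_wpM2l.
have {h1} h1 : quad 2 <= t ^+ 2 * quad 0.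
  by move: h1; rewrite ler_pXn2r ?nnegrE ?exprn_ge0// /m ler_pdivrMr.
have h2 : quad 1 ^+ 2 <= (t * quad 0) ^+ 2.
  apply: le_trans (quad_CauchySchwarz 0 1) _.
  have -> : (t * quad 0) ^+ 2 = quad 0 * (t ^+ 2 * quad 0) by ring.
  by rewrite ler_wpM2l.
have [/le_trans->//|/ltW q1] := lerP (quad 1) 0; first by rewrite mulr_ge0.
by rewrite -(@ler_pXn2r _ 2)// nnegrE// mulr_ge0.
Qed.

End QuadraticMoments.

(** [logconvex_pow] at a basis vector, where [quad 0] is [1]; it provides the power hypothesis of
    [young_pow]. *)
Lemma diag_moment_pow (R : realFieldType) d (S : 'M[R]_d) l k : S^T = S ->
  (S ^+ k.*2) l l ^+ k.+1 <= (S ^+ k.+1.*2) l l ^+ k.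
Proof.
move=> Ssym; pose z : 'cV[R]_d := delta_mx l 0.
have qE j : quad S z j = (S ^+ j) l l.
  by rewrite /quad /z trmx_delta -rowE -colE !mxE.
rewrite -!qE; apply: (@logconvex_pow R (fun k => quad S z k.*2)).
- by rewrite qE expr0 mxE eqxx.
- exact: quad_double_ge0.
- exact: quad_logconvex.
Qed.

Section MatrixRosenthal.
Variables (R : realFieldType) (T : finType) (d : nat).
Variables (Z : T -> 'M[R]_d) (D : T -> 'rV[R]_d).
Hypothesis T_gt0 : (0 < #|T|)%N.
Hypothesis Zsym : forall a, (Z a)^T = Z a.
Hypothesis Zsq : forall a, Z a ^+ 2 = diag_mx (D a).

Definition centered (a : T) : 'M[R]_d := Z a - #|T|%:R^-1 *: \sum_b Z b.

Definition csum (s : seq T) : 'M[R]_d := \sum_(a <- s) centered a.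

(** Diagonal of the sum over the draws of [Z a ^+ 2] plus its mean: the draw and its independent
    copy each contribute one half. *)
Definition qvar (s : seq T) (l : 'I_d) : R :=
  \sum_(a <- s) D a 0 l + (size s)%:R * avg (fun a => D a 0 l).

Lemma centered_sym a : (centered a)^T = centered a.
Proof.
rewrite /centered linearB /= linearZ /= linear_sum /= Zsym.
by congr (_ - _ *: _); apply: eq_bigr => b _; rewrite Zsym.
Qed.

Lemma csum_sym s : (csum s)^T = csum s.
Proof. by rewrite /csum linear_sum; apply: eq_bigr => a _; apply: centered_sym. Qed.

(** Parallelogram law; the discarded term with [X + Y] is the trace of a Gram matrix. *)
Lemma mxtrace_sqrB (X Y C : 'M[R]_d) : X^T = X -> Y^T = Y -> C^T = C ->
  \tr ((X - Y) ^+ 2 * C ^+ 2) <= 2 * (\tr (X ^+ 2 * C ^+ 2) + \tr (Y ^+ 2 * C ^+ 2)).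
Proof.
move=> Xs Ys Cs.
have := mxtrace_gram_ge0 ((X + Y) *m C).
rewrite trmx_mul [(X + Y)^T]linearD /= Xs Ys Cs.
have -> : \tr (C *m (X + Y) *m ((X + Y) *m C)) = \tr ((X + Y) ^+ 2 * C ^+ 2).
  by rewrite !expr2 -!mulmxE -!mulmxA mxtrace_mulC -!mulmxA.
suff : \tr ((X - Y) ^+ 2 * C ^+ 2) + \tr ((X + Y) ^+ 2 * C ^+ 2) =
   2 * (\tr (X ^+ 2 * C ^+ 2) + \tr (Y ^+ 2 * C ^+ 2)) by lra.
rewrite -!linearD /= mulr_natl -linearMn /= -!mulrDl -mulrnAl; congr (\tr (_ * _)).
rewrite !expr2 !mulrDl !mulrDr !mulNr !mulrN !opprK; move: (X * X) (X * Y) (Y * X) (Y * Y).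
move=> a b c e; apply/matrixP => i j; rewrite !mxE; ring.
Qed.

(* Resampling one draw: averaging over an independent copy [b] of [a] replaces [centered a] by
   [Z a - Z b], and antisymmetrizing in [a, b] turns the odd power into a difference of powers. *)
Lemma exchange_bound (rho : 'M[R]_d) r : rho^T = rho ->
  avg (fun a => \tr (centered a * (rho + centered a) ^+ r.*2.+1)) <=
  2 * r.*2.+1%:R * avg (fun a => \tr (Z a ^+ 2 * (rho + centered a) ^+ r.*2) +
                     avg (fun b => \tr (Z b ^+ 2 * (rho + centered a) ^+ r.*2))).
Proof.
move=> rs; pose A a := rho + centered a.
have As a : (A a)^T = A a by rewrite /A [(_ + _)^T]linearD /= rs centered_sym.
have AB a b : A a - A b = Z a - Z b.
  by rewrite /A /centered opprD addrACA subrr add0r opprB addrA subrK.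
pose F a b := \tr ((Z a - Z b) * A a ^+ r.*2.+1).
have -> : avg (fun a => \tr (centered a * A a ^+ r.*2.+1)) = avg (fun a => avg (F a)).
  apply: eq_avg => a; rewrite /F.
  rewrite (eq_avg (h := fun b => \tr (Z a * A a ^+ r.*2.+1) +
     (-1) * \tr (Z b * A a ^+ r.*2.+1))); last first.
    by move=> b; rewrite mulrBl [LHS]linearB /= mulN1r.
  rewrite avgD avg_cst// avgZ /centered mulrBl [LHS]linearB /= mulN1r; congr (_ - _).
  rewrite -mulmxE -scalemxAl [LHS]linearZ /= mulmx_suml linear_sum /= /avg mulrC.
  by congr (_ * _).
have symF : 2 * avg (fun a => avg (F a)) = avg (fun a => avg (fun b =>
    \tr ((A a - A b) * (A a ^+ r.*2.+1 - A b ^+ r.*2.+1)))).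
  rewrite mulr_natl mulr2n {2}avg_swap -avgD; apply: eq_avg => a.
  rewrite -avgD; apply: eq_avg => b; rewrite /F AB mulrBr [RHS]linearB /=.
  by congr (_ + _); rewrite -[Z b - Z a]opprB mulNr [LHS]linearN.
pose G a b := \tr ((Z a - Z b) ^+ 2 * A a ^+ r.*2).
have le1 : 2 * avg (fun a => avg (F a)) <= r.*2.+1%:R * (2 * avg (fun a => avg (G a))).
  have -> : 2 * avg (fun a => avg (G a)) = avg (fun a => avg (fun b => G a b + G b a)).
    rewrite mulr_natl mulr2n {2}avg_swap -avgD; apply: eq_avg => a.
    by rewrite -avgD; apply: eq_avg => b.
  rewrite symF -avgZ; apply: le_avg => a; rewrite -avgZ; apply: le_avg => b.
  apply: le_trans (mxtrace_pow_diff _ (As a) (As b)) _; rewrite !AB /G.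
  by rewrite -[Z b - Z a]opprB sqrrN.
have le2 : avg (fun a => avg (G a)) <= 2 * avg (fun a => \tr (Z a ^+ 2 * A a ^+ r.*2) +
                     avg (fun b => \tr (Z b ^+ 2 * A a ^+ r.*2))).
  rewrite -avgZ; apply: le_avg => a.
  rewrite -[X in _ <= _ * (X + _)](avg_cst T_gt0) -avgD -avgZ; apply: le_avg => b.
  rewrite /G -muln2 exprM; apply: mxtrace_sqrB => //; exact: trmx_exp_sym.
rewrite -/(A _); have : (0 : R) <= r.*2.+1%:R by [].
move: le1 le2; set x := avg _; set y := avg _; set w := avg _; move: (r.*2.+1%:R) => k.
by nra.
Qed.

(** One factor of the power is expanded as a sum over draws. Each draw then meets a [rho] made of
    the other draws, which is independent of it, and [exchange_bound] applies conditionally on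
    [rho]. *)
Lemma Ex_csum_step q r :
  Ex q (fun s => \tr (csum s ^+ r.*2.+2)) <=
  2 * r.*2.+1%:R * Ex q (fun s => \sum_l qvar s l * (csum s ^+ r.*2) l l).
Proof.
case: q => [|q].
  rewrite /Ex /csum big_nil expr0n /= mxtrace0 !mulr_ge0//=.
  by apply: sumr_ge0 => l _; rewrite /qvar big_nil mul0r addr0 mul0r.
pose psi a (rho : 'M[R]_d) := \tr (centered a * (rho + centered a) ^+ r.*2.+1).
pose chi a (rho : 'M[R]_d) := \tr (Z a ^+ 2 * (rho + centered a) ^+ r.*2) +
                     avg (fun b => \tr (Z b ^+ 2 * (rho + centered a) ^+ r.*2)).
rewrite (eq_Ex (psi := fun s => \sum_(a <- s) psi a (\sum_(b <- s) centered b - centered a)));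
  last first.
  move=> s _; rewrite /psi; under [RHS]eq_bigr do rewrite subrK.
  by rewrite -linear_sum /= -mulr_suml -exprS.
rewrite [in leRHS](eq_Ex (psi := fun s =>
    \sum_(a <- s) chi a (\sum_(b <- s) centered b - centered a))); last first.
  move=> s _; rewrite /chi; under [RHS]eq_bigr do rewrite subrK.
  rewrite big_split /= big_const_seq count_predT iter_addr_0 -/(csum s).
  have trD (C : 'M[R]_d) a : \tr (Z a ^+ 2 * C) = \sum_l D a 0 l * C l l.
    by rewrite Zsq; apply: eq_bigr => l _; rewrite -mulmxE mul_diag_mx mxE.
  rewrite (eq_bigr _ (fun a _ => trD _ a)) (eq_avg (fun a => trD _ a)).
  rewrite avg_sum exchange_big /= -mulr_natl mulr_sumr -big_split /=.
  apply: eq_bigr => l _; rewrite /qvar mulrDl -mulr_suml -mulrA; congr (_ + _ * _).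
  by rewrite mulrC -avgZ; apply: eq_avg => a; rewrite mulrC.
rewrite (Ex_sum_rest centered psi) (Ex_sum_rest centered chi).
rewrite [leRHS]mulrCA ler_wpM2l// -!Ex_avg -ExZ; apply: le_Ex => s _.
exact/exchange_bound/csum_sym.
Qed.

Hypothesis D_ge0 : forall a l, 0 <= D a 0 l.

Lemma qvar_ge0 s l : 0 <= qvar s l.
Proof.
rewrite addr_ge0 ?sumr_ge0// mulr_ge0//.
by rewrite /avg divr_ge0// sumr_ge0.
Qed.

(* Stated for matrices with diagonal squares, which is what the dilations of single entries are:
   the variance proxy [qvar] is then scalar on each coordinate, and Young's inequality absorbs
   the moment of [csum] into the left-hand side. *)
Lemma matrix_Rosenthal q r :
  Ex q (fun s => \tr (csum s ^+ r.+1.*2)) <=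
  (4 * r.*2.+1%:R) ^+ r.+1 * \sum_l Ex q (fun s => qvar s l ^+ r.+1).
Proof.
set x := Ex q _; set M := \sum_l _; set k : R := r.*2.+1%:R.
have k0 : 0 < k by rewrite ltr0n.
(* With this [eta] the term [2 k eta x] is [x / 2], which the left-hand side absorbs. *)
pose eta : R := (4 * k)^-1.
have e0 : 0 < eta by rewrite invr_gt0 mulr_gt0.
have step : x <= 2 * k * (eta * x + M / eta ^+ r).
  apply: le_trans (Ex_csum_step q r) _; rewrite ler_pM2l ?mulr_gt0//.
  rewrite /x /M -ExZ -Ex_sum mulrC -ExZ -ExD; apply: le_Ex => s _.
  rewrite mulr_sumr mulr_sumr -big_split /=; apply: ler_sum => l _.
  rewrite [eta ^- r * _]mulrC; apply: young_pow => //; first exact: qvar_ge0.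
  - have := quad_double_ge0 (delta_mx l 0) (csum_sym s) r.
    by rewrite /quad trmx_delta -rowE -colE !mxE.
  - have := quad_double_ge0 (delta_mx l 0) (csum_sym s) r.+1.
    by rewrite /quad trmx_delta -rowE -colE !mxE.
  - exact/diag_moment_pow/csum_sym.
have -> : (4 * k) ^+ r.+1 = eta^-1 / eta ^+ r by rewrite /eta -exprVn invrK exprS.
have kE : k = eta^-1 / 4 by rewrite /eta invrK; field.
have -> : eta^-1 / eta ^+ r * M = eta^-1 * (M / eta ^+ r) by rewrite -mulrA [_ * M]mulrC.
move: step; rewrite {1}kE; set y := M / _.
have -> : 2 * (eta^-1 / 4) * (eta * x + y) = x / 2 + eta^-1 * y / 2 by field; rewrite gt_eqF.
lra.
Qed.

End MatrixRosenthal.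

(** * Exponential moments *)

Section Exponential.
Implicit Types x y : R.

Lemma expD x y : exp (x + y) = exp x * exp y.
Proof. exact: exp_plus. Qed.

Lemma expr0E : exp 0 = 1.
Proof. exact: exp_0. Qed.

Lemma exp_gt0 x : 0 < exp x.
Proof. exact/RltP/exp_pos. Qed.

Lemma exp_ge1D x : 1 + x <= exp x.
Proof. exact/RleP/exp_ineq1_le. Qed.

Lemma expN x : exp (- x) = (exp x)^-1.
Proof.
apply: (mulIf (lt0r_neq0 (exp_gt0 x))).
by rewrite -expD addNr expr0E mulVf ?gt_eqF ?exp_gt0.
Qed.

Lemma ler_exp x y : x <= y -> exp x <= exp y.
Proof.
move=> xy; rewrite -[y](subrK x) expD -[leLHS]mul1r ler_wpM2r ?(ltW (exp_gt0 _))//.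
by apply: le_trans (exp_ge1D _); rewrite lerDl subr_ge0.
Qed.

Lemma exp_natM n x : exp (n%:R * x) = exp x ^+ n.
Proof.
elim: n => [|n IH]; first by rewrite mul0r expr0E expr0.
by rewrite -natr1 mulrDl mul1r expD IH exprSr.
Qed.

Lemma exp_sum (I : Type) (r : seq I) (f : I -> R) :
  exp (\sum_(i <- r) f i) = \prod_(i <- r) exp (f i).
Proof.
by apply: (big_morph exp expD expr0E).
Qed.

(** From [1 - x <= exp (- x)] comes [(1 - x) exp x <= 1], while [(1 - x) (1 + x + 2 x^2) = 1 + x^2
    (1 - 2 x)] is at least [1]. *)
Lemma exp_le_quad x : `|x| <= 2^-1 -> exp x <= 1 + x + 2 * x ^+ 2.
Proof.
rewrite ler_norml => /andP[x1 x2].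
have h := exp_ge1D (- x); rewrite expN in h.
have e0 := exp_gt0 x.
have : (1 - x) * exp x <= 1.
  by rewrite -ler_pdivlMr// div1r.
have : 1 <= (1 - x) * (1 + x + 2 * x ^+ 2) by nra.
have : 0 < 1 - x by lra.
by move=> x0 le1 le2; rewrite -(ler_pM2l x0); lra.
Qed.

Lemma exp_le_1D2 x : 0 <= x <= 2^-1 -> exp x <= 1 + 2 * x.
Proof.
move=> /andP[x0 x1]; apply: le_trans (exp_le_quad _) _; first by rewrite ger0_norm.
by nra.
Qed.

Lemma pow_le_exp n x : 0 <= x -> x ^+ n <= exp (n%:R * x).
Proof.
move=> x0; rewrite exp_natM; apply: lerXn2r; rewrite ?nnegrE ?(ltW (exp_gt0 _))//.
by apply: le_trans (exp_ge1D x); rewrite lerDr.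
Qed.

Lemma exp_nat4 : exp 4 <= 81.
Proof.
have h3 : exp 1 <= 3 by apply/RleP; have := exp_le_3; rewrite !RealsE.
rewrite -[4](mulr1 4) exp_natM; apply: le_trans (_ : 3 ^+ 4 <= _); last by lra.
by apply: lerXn2r; rewrite ?nnegrE ?(ltW (exp_gt0 _)).
Qed.

End Exponential.

Section Probability.
Variable T : finType.
Hypothesis T_gt0 : (0 < #|T|)%N.
Implicit Types P Q : seq T -> Prop.

Definition Pr (q : nat) P : R := Ex q (fun s => `[< P s >]%:R).

Lemma le_Pr q P Q : (forall s, size s = q -> P s -> Q s) -> Pr q P <= Pr q Q.
Proof.
move=> PQ; apply: le_Ex => s sq; rewrite ler_nat; case: asboolP => // /(PQ _ sq) Qs.
by rewrite asboolT.
Qed.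

Lemma Pr_or q P Q : Pr q (fun s => P s \/ Q s) <= Pr q P + Pr q Q.
Proof.
rewrite /Pr -ExD; apply: le_Ex => s _; rewrite -natrD ler_nat.
by rewrite asbool_or; case: `[< _ >]; case: `[< _ >].
Qed.

Lemma Pr_exists q (I : finType) (P : I -> seq T -> Prop) (e : R) :
  (forall i, Pr q (P i) <= e) -> Pr q (fun s => exists i, P i s) <= #|I|%:R * e.
Proof.
move=> Pe; rewrite mulr_natl -sumr_const.
apply: le_trans (_ : \sum_i Pr q (P i) <= _); last exact: ler_sum.
rewrite /Pr -Ex_sum; apply: le_Ex => s _.
have [[i Pi]|_] := asboolP; last by apply: sumr_ge0.
by rewrite (bigD1 i)//= asboolT// lerDl sumr_ge0.
Qed.

Lemma Markov q P (f : seq T -> R) : (forall s, 0 <= f s) ->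
  (forall s, size s = q -> P s -> 1 <= f s) -> Pr q P <= Ex q f.
Proof. by move=> f0 Pf; apply: le_Ex => s sq; case: asboolP => // /(Pf _ sq). Qed.

(** Conditional union bound: [Q] collects the bad first batches, and after any other the failure
    probability is at most [e]. *)
Lemma Pr_cat q1 q2 P (Q : seq T -> Prop) (e : R) : 0 <= e ->
  (forall s1, size s1 = q1 -> ~ Q s1 -> Pr q2 (fun s2 => P (s1 ++ s2)) <= e) ->
  Pr (q1 + q2) P <= Pr q1 Q + e.
Proof.
move=> e0 h; rewrite /Pr Ex_cat -[e](Ex_cst T_gt0 q1) -ExD; apply: le_Ex => s1 sq.
have [Qs|nQs] := asboolP; last by rewrite add0r; apply: h.
apply: le_trans (_ : 1 <= _); last by rewrite lerDl.
by rewrite -[leRHS](Ex_cst T_gt0 q2); apply: le_Ex => s _; rewrite lern1 leq_b1.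
Qed.

Lemma Ex_exp_sum q (g : T -> R) :
  Ex q (fun s => exp (\sum_(a <- s) g a)) = avg (fun a => exp (g a)) ^+ q.
Proof. by rewrite -Ex_prod; apply: eq_Ex => s _; rewrite exp_sum. Qed.

Lemma Ex_qvar_pow (d : nat) (D : T -> 'rV[R]_d) (l : 'I_d) (kappa : R) (q p : nat) :
  (forall a, 0 <= D a 0 l <= 1) -> avg (fun a => D a 0 l) <= kappa ->
  (0 < p)%N -> 2 * p%:R <= q%:R * kappa ->
  Ex q (fun s => qvar D s l ^+ p) <= (q%:R * kappa) ^+ p * exp (3 * p%:R).
Proof.
move=> D01 Dk p0 qk; set m := avg _ in Dk.
have pgt0 : (0 : R) < p%:R by rewrite ltr0n.
have m0 : 0 <= m.
  by rewrite /m /avg divr_ge0// sumr_ge0// => a _; have /andP[] := D01 a.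
(* Since [p b = q kappa], the power [V^p] is at most [(q kappa)^p exp (V / b)]. As [b >= 2], every
   summand divided by [b] stays in the range where [exp] is at most [1 + 2 x]. *)
pose b : R := q%:R * kappa / p%:R.
have b2 : 2 <= b by rewrite ler_pdivlMr.
have bgt0 : 0 < b by apply: lt_le_trans b2.
have pb : q%:R * kappa = p%:R * b by rewrite /b; field; rewrite gt_eqF.
have qk0 : 0 <= (q%:R * kappa) ^+ p by rewrite exprn_ge0// (le_trans _ qk)// mulr_ge0.
clearbody b.
apply: le_trans (_ : Ex q (fun s => (q%:R * kappa) ^+ p *
    exp (\sum_(a <- s) ((D a 0 l + m) / b))) <= _).
  apply: le_Ex => s sq; rewrite -mulr_suml big_split /= big_const_seq count_predT iter_addr_0.
  rewrite -[m *+ _]mulr_natl -/(qvar D s l); set V := qvar D s l.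
  have V0 : 0 <= V.
    rewrite addr_ge0//; last by rewrite mulr_ge0.
    by apply: sumr_ge0 => a _; have /andP[] := D01 a.
  have -> : V ^+ p = (q%:R * kappa) ^+ p * (V / (p%:R * b)) ^+ p.
    by rewrite -exprMn pb mulrC divfK// mulf_neq0// gt_eqF.
  rewrite ler_wpM2l//.
  apply: le_trans (pow_le_exp _ _) _; first by rewrite divr_ge0// mulr_ge0// ltW.
  by rewrite invfM mulrCA mulVKf// gt_eqF.
rewrite ExZ ler_wpM2l// Ex_exp_sum.
apply: le_trans (_ : exp (3 * m / b) ^+ q <= _).
  apply: lerXn2r; rewrite ?nnegrE ?(ltW (exp_gt0 _))//.
    by rewrite divr_ge0// sumr_ge0// => a _; rewrite ltW ?exp_gt0.
  have -> : 3 * m / b = m / b + 2 * (m / b) by field; rewrite gt_eqF.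
  rewrite expD; apply: le_trans (_ : exp (m / b) * (1 + 2 * (m / b)) <= _); last first.
    by rewrite ler_wpM2l ?(ltW (exp_gt0 _))// exp_ge1D.
  have -> : 1 + 2 * (m / b) = avg (fun a => 1 + 2 / b * D a 0 l).
    by rewrite avgD avg_cst// avgZ -/m; field; rewrite gt_eqF.
  rewrite -avgZ.
  apply: le_avg => a; rewrite mulrDl expD mulrC ler_wpM2l ?(ltW (exp_gt0 _))//.
  have /andP[D0 D1] := D01 a.
  apply: le_trans (exp_le_1D2 _) _; last by rewrite mulrAC -mulrA.
  by rewrite divr_ge0 ?(ltW bgt0)//= ler_pdivrMr//; lra.
rewrite -exp_natM; apply: ler_exp; rewrite mulrA ler_pdivrMr// mulrCA -mulrA -pb.
by rewrite ler_wpM2l// ler_wpM2l.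
Qed.

End Probability.

(** * Operator norm of the sampling error *)

Section OperatorNorm.
Variables (F : realFieldType) (m n : nat).
Implicit Types (A B : 'M[F]_(m, n)) (t : F).

Definition bil A (x : 'cV[F]_m) (y : 'cV[F]_n) : F := (x^T *m A *m y) 0 0.

Definition sqn k (x : 'cV[F]_k) : F := (x^T *m x) 0 0.

(* [op_le A t] says that the operator norm of [A] is at most [t]; the AM-GM form is equivalent
   to [x^T A y <= t |x| |y|] by rescaling, and avoids square roots. *)
Definition op_le A t : Prop := forall x y, 2 * bil A x y <= t * (sqn x + sqn y).

Lemma sqn_ge0 k (x : 'cV[F]_k) : 0 <= sqn x.
Proof. by rewrite /sqn mxE; apply: sumr_ge0 => i _; rewrite mxE -expr2 sqr_ge0. Qed.

Lemma bilD A B x y : bil (A + B) x y = bil A x y + bil B x y.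
Proof. by rewrite /bil mulmxDr mulmxDl mxE. Qed.

Lemma bilZ c A x y : bil (c *: A) x y = c * bil A x y.
Proof. by rewrite /bil -scalemxAr -scalemxAl mxE. Qed.

Lemma op_leD A B s t : op_le A s -> op_le B t -> op_le (A + B) (s + t).
Proof. by move=> hA hB x y; rewrite bilD mulrDr [leRHS]mulrDl lerD. Qed.

Lemma op_leZ c A t : 0 <= c -> op_le A t -> op_le (c *: A) (c * t).
Proof. by move=> c0 hA x y; rewrite bilZ mulrCA -mulrA ler_wpM2l. Qed.

Lemma op_le_trans A s t : op_le A s -> s <= t -> op_le A t.
Proof. by move=> hA st x y; apply: le_trans (hA x y) _; rewrite ler_wpM2r ?addr_ge0 ?sqn_ge0. Qed.

Definition dil A : 'M[F]_(m + n) := block_mx 0 A A^T 0.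

Lemma dil_sym A : (dil A)^T = dil A.
Proof. by rewrite /dil tr_block_mx !trmx0 trmxK. Qed.

Lemma dilD A B : dil (A + B) = dil A + dil B.
Proof. by rewrite /dil add_block_mx !addr0 [(A + B)^T]linearD. Qed.

Lemma dilZ c A : dil (c *: A) = c *: dil A.
Proof. by rewrite /dil scale_block_mx !scaler0 [(c *: A)^T]linearZ. Qed.

Lemma dil0 : dil 0 = 0.
Proof. by rewrite -(scale0r (0 : 'M_(m, n))) dilZ scale0r. Qed.

Lemma dil_sum (I : Type) (r : seq I) (G : I -> 'M[F]_(m, n)) :
  dil (\sum_(i <- r) G i) = \sum_(i <- r) dil (G i).
Proof. exact: (big_morph dil dilD dil0). Qed.

Lemma op_le_dil A k t : (0 < k)%N -> 0 <= t ->
  \tr (dil A ^+ k.*2) <= t ^+ k.*2 -> op_le A t.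
Proof.
move=> k0 t0 le_t x y.
have := quad1_le_of_mxtrace (col_mx x y) (dil_sym A) k0 t0 le_t.
rewrite /quad expr1 expr0 mulmx1 /dil tr_col_mx mul_row_block !mulmx0 addr0 add0r.
have addE (P Q : 'M[F]_1) : (P + Q) 0 0 = P 0 0 + Q 0 0 by rewrite mxE.
rewrite !mul_row_col !addE.
have -> : (y^T *m A^T *m x) 0 0 = bil A x y.
  have -> : y^T *m A^T *m x = (x^T *m A *m y)^T by rewrite !trmx_mul trmxK mulmxA.
  by rewrite mxE.
by rewrite -/(bil A x y) -/(sqn x) -/(sqn y) mulr_natl mulr2n addrC.
Qed.

End OperatorNorm.

Section Sampling.
Variables (n1 n2 : nat).
Hypotheses (n1_gt0 : (0 < n1)%N) (n2_gt0 : (0 < n2)%N).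
Notation T := ('I_n1 * 'I_n2)%type.
Notation M := 'M[R]_(n1, n2).
Notation N := (n1 * n2)%N.

Lemma card_entries : #|{: T}| = N.
Proof. by rewrite card_prod !card_ord. Qed.

Lemma entries_gt0 : (0 < #|{: T}|)%N.
Proof. by rewrite card_entries muln_gt0 n1_gt0. Qed.

Definition samp (q : nat) (s : seq T) (W : M) : M :=
  \sum_(a <- s) (N%:R / q%:R * W a.1 a.2) *: delta_mx a.1 a.2.

Section OneMatrix.
Variables (W : M) (w : R).
Hypotheses (w_gt0 : 0 < w) (W_le : forall i j, `|W i j| <= w).

Let th (a : T) : R := W a.1 a.2 / w.
Let Z (a : T) : 'M[R]_(n1 + n2) := th a *: dil (delta_mx a.1 a.2).
Let D (a : T) : 'rV[R]_(n1 + n2) :=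
  th a ^+ 2 *: row_mx (delta_mx 0 a.1) (delta_mx 0 a.2).

Let th2_le1 a : 0 <= th a ^+ 2 <= 1.
Proof.
rewrite sqr_ge0 /= -[th a ^+ 2]ger0_norm ?sqr_ge0// normrX exprn_ile1//.
by rewrite normrM normfV [`|w|]gtr0_norm// ler_pdivrMr// mul1r.
Qed.

Let Zsym a : (Z a)^T = Z a.
Proof. by rewrite /Z linearZ /= dil_sym. Qed.

Let Zsq a : Z a ^+ 2 = diag_mx (D a).
Proof.
rewrite expr2 /Z -mulmxE -scalemxAl -scalemxAr scalerA -expr2 /D [RHS]linearZ /=; congr (_ *: _).
rewrite /dil mulmx_block !mulmx0 !mul0mx !addr0 !add0r trmx_delta !mul_delta_mx.
have diag_delta k (c : 'I_k) : delta_mx c c = diag_mx (delta_mx 0 c) :> 'M[R]_k.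
  apply/matrixP => i j; rewrite !mxE eqxx /=.
  case: (eqVneq i j) => [->|ij]; first by rewrite andbb.
  by apply/eqP; rewrite mulr0n pnatr_eq0 eqb0; apply: contra ij => /andP[/eqP-> /eqP->].
by rewrite diag_mx_row -!diag_delta.
Qed.

Let D01 a l : 0 <= D a 0 l <= 1.
Proof.
have /andP[t0 t1] := th2_le1 a.
rewrite !mxE; case: splitP => j _; rewrite mxE /=; case: eqP;
  by rewrite ?mulr1 ?mulr0 ?t0 ?t1 ?lexx ?ler01.
Qed.

Let D_avg (kappa : R) l : n1%:R^-1 <= kappa -> n2%:R^-1 <= kappa ->
  avg (fun a => D a 0 l) <= kappa.
Proof.
move=> k1 k2.
have n1N : n1%:R != 0 :> R by rewrite pnatr_eq0 -lt0n.
have n2N : n2%:R != 0 :> R by rewrite pnatr_eq0 -lt0n.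
rewrite -(splitK l); case: (split l) => k /=; rewrite /avg card_entries.
- apply: le_trans k1; rewrite ler_pdivrMr ?ltr0n ?muln_gt0 ?n1_gt0// natrM mulKf//.
  apply: le_trans (_ : \sum_(a : T) (a.1 == k)%:R <= _).
    apply: ler_sum => a _; rewrite mxE row_mxEl mxE eqxx /= eq_sym.
    by have /andP[t0 t1] := th2_le1 a; case: eqP => _; rewrite ?mulr1 ?mulr0.
  rewrite -(pair_bigA _ (fun i (j : 'I_n2) => (i == k)%:R)) /= (bigD1 k)//= eqxx.
  rewrite sumr_const card_ord big1 ?addr0// => i /negPf ->; exact: big1.
- apply: le_trans k2; rewrite ler_pdivrMr ?ltr0n ?muln_gt0 ?n1_gt0// natrM mulrC mulfK//.
  apply: le_trans (_ : \sum_(a : T) (a.2 == k)%:R <= _).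
    apply: ler_sum => a _; rewrite mxE row_mxEr mxE eqxx /= eq_sym.
    by have /andP[t0 t1] := th2_le1 a; case: eqP => _; rewrite ?mulr1 ?mulr0.
  rewrite -(pair_bigA _ (fun (i : 'I_n1) j => (j == k)%:R)) exchange_big /= (bigD1 k)//= eqxx.
  rewrite sumr_const card_ord big1 ?addr0// => i /negPf ->; exact: big1.
Qed.

Let csumE q s : (0 < q)%N -> size s = q ->
  csum Z s = dil ((q%:R / N%:R / w) *: (samp q s W - W)).
Proof.
move=> q0 sq.
have qN : q%:R != 0 :> R by rewrite pnatr_eq0 -lt0n.
have NN : N%:R != 0 :> R by rewrite pnatr_eq0 -lt0n muln_gt0 n1_gt0.
rewrite /csum /centered big_split /= big_const_seq count_predT iter_addr_0 sq.
rewrite scalerBr /samp -[_ - _]/(_ + _) dilD; congr (_ + _).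
  rewrite scaler_sumr dil_sum; apply: eq_bigr => a _.
  rewrite scalerA dilZ /Z /th; congr (_ *: _).
  by field; rewrite qN gt_eqF//= !pnatr_eq0 -!lt0n n1_gt0 n2_gt0.
rewrite -scalerN -scaleN1r scalerA dilZ.
have -> : \sum_b Z b = w^-1 *: dil W.
  rewrite /Z [in RHS](matrix_sum_delta W) pair_bigA /= dil_sum scaler_sumr.
  by apply: eq_bigr => a _; rewrite dilZ scalerA mulrC.
rewrite card_entries scalerA -scaler_nat -[- (_ *: _)]scaleN1r !scalerA; congr (_ *: _).
by field; rewrite gt_eqF//= !pnatr_eq0 -!lt0n n1_gt0 n2_gt0.
Qed.

(** Markov's inequality for the trace of the power [2 p]. In [8 * exp 4 * p], the factor [8 p]
    bounds the Rosenthal constant [4 (2 p - 1)], [exp 3] comes from [Ex_qvar_pow], and the last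
    [exp 1] makes each of the [p] factors at most [exp (-1)]. *)
Lemma Pr_samp_op q p (kappa tau : R) :
  n1%:R^-1 <= kappa -> n2%:R^-1 <= kappa -> (0 < p)%N -> 2 * p%:R <= q%:R * kappa ->
  0 < tau -> 8 * exp 4 * p%:R * (q%:R * kappa) <= tau ^+ 2 ->
  Pr q (fun s => ~ op_le (samp q s W - W) (N%:R / q%:R * w * tau)) <=
  (n1 + n2)%:R * exp (- p%:R).
Proof.
move=> k1 k2 p0 qk tau0 htau.
have pgt0 : (0 : R) < p%:R by rewrite ltr0n.
have qkgt0 : 0 < q%:R * kappa by apply: lt_le_trans qk; rewrite mulr_gt0.
have q0 : (0 < q)%N by rewrite lt0n; apply: contraTneq qkgt0 => ->; rewrite mul0r ltxx.
have qN : q%:R != 0 :> R by rewrite pnatr_eq0 -lt0n.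
have N0 : (0 < N)%N by rewrite muln_gt0 n1_gt0.
have NN : N%:R != 0 :> R by rewrite pnatr_eq0 -lt0n.
have t20 : 0 < tau ^+ p.*2 by rewrite exprn_gt0.
apply: le_trans (@Markov _ q _ (fun s => (tau ^+ p.*2)^-1 * \tr (csum Z s ^+ p.*2)) _ _) _.
- move=> s; rewrite mulr_ge0 ?invr_ge0 ?(ltW t20)// -addnn exprD.
  by rewrite -{1}(trmx_exp_sym (csum_sym Zsym s)) mxtrace_gram_ge0.
- move=> s sq; apply: contra_notT; rewrite -ltNge mulrC ltr_pdivrMr// mul1r (csumE q0 sq).
  move=> /ltW h.
  have c0 : 0 < q%:R / N%:R / w by rewrite !divr_gt0 ?ltr0n.
  have := op_le_dil p0 (ltW tau0) h.
  move=> /(op_leZ (ltW (_ : 0 < (q%:R / N%:R / w)^-1))); rewrite invr_gt0 => /(_ c0).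
  rewrite scalerA mulVf ?gt_eqF// scale1r !invfM !invrK.
  by rewrite [_^-1 * _]mulrC.
rewrite ExZ -(prednK p0) in htau *; set r := p.-1.
apply: le_trans (_ : (tau ^+ r.+1.*2)^-1 * ((4 * r.*2.+1%:R) ^+ r.+1 *
   ((n1 + n2)%:R * ((q%:R * kappa) ^+ r.+1 * exp (3 * r.+1%:R)))) <= _).
  rewrite ler_wpM2l ?invr_ge0 ?exprn_ge0 ?(ltW tau0)//.
  apply: le_trans (matrix_Rosenthal entries_gt0 Zsym Zsq _ q r) _.
    by move=> a l; have /andP[] := D01 a l.
  rewrite ler_wpM2l ?exprn_ge0 ?mulr_ge0// [leRHS]mulr_natl -[X in _ *+ X]card_ord -sumr_const.
  apply: ler_sum => l _; apply: Ex_qvar_pow; first exact: entries_gt0.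
  - by move=> a; apply: D01.
  - exact: D_avg.
  - by [].
  - by rewrite /r prednK.
have -> : (tau ^+ r.+1.*2)^-1 * ((4 * r.*2.+1%:R) ^+ r.+1 *
   ((n1 + n2)%:R * ((q%:R * kappa) ^+ r.+1 * exp (3 * r.+1%:R)))) =
   (n1 + n2)%:R * (4 * r.*2.+1%:R * (q%:R * kappa) * exp 3 / tau ^+ 2) ^+ r.+1.
  rewrite [3 * _]mulrC exp_natM -mul2n exprM -exprVn -(mulrA 4) !(exprMn r.+1).
  by move: (_ ^+ r.+1) (_ ^+ r.+1) (_ ^+ r.+1) => a b c; ring.
rewrite ler_wpM2l// -[r.+1%:R]mulr1 -mulrN exp_natM.
apply: lerXn2r; rewrite ?nnegrE ?(ltW (exp_gt0 _))//.
  by rewrite divr_ge0 ?sqr_ge0// mulr_ge0 ?(ltW (exp_gt0 _))// mulr_ge0 ?(ltW qkgt0)// mulr_ge0.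
rewrite ler_pdivrMr ?exprn_gt0// expN [leRHS]mulrC.
have e1 := exp_gt0 1.
rewrite ler_pdivlMr//.
have e4 : exp 4 = exp 3 * exp 1 by rewrite -expD; congr exp; lra.
apply: le_trans htau; rewrite e4.
have kE : 4 * r.*2.+1%:R <= 8 * r.+1%:R :> R.
  by rewrite -!natrM ler_nat; lia.
have v0 : 0 <= q%:R * kappa * exp 3 * exp 1.
  by rewrite mulr_ge0 ?(ltW e1)// mulr_ge0 ?(ltW (exp_gt0 _))// ltW.
have := ler_wpM2r v0 kE; lra.
Qed.

End OneMatrix.
End Sampling.

(** * Tangent space *)

Section TangentSpace.
Variables (F : realFieldType) (n1 n2 r : nat).
Variables (U : 'M[F]_(n1, r)) (V : 'M[F]_(n2, r)).
Hypotheses (U_ortho : U^T *m U = 1%:M) (V_ortho : V^T *m V = 1%:M).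
Implicit Types X Y : 'M[F]_(n1, n2).

Definition inner X Y : F := \sum_i \sum_j X i j * Y i j.

Let PU : 'M[F]_n1 := U *m U^T.
Let PV : 'M[F]_n2 := V *m V^T.

Definition PT X := U *m U^T *m X + X *m (V *m V^T) - U *m U^T *m X *m (V *m V^T).
Definition PTp X := (1%:M - U *m U^T) *m X *m (1%:M - V *m V^T).

Lemma PT_PTp X : X = PT X + PTp X.
Proof.
rewrite /PT /PTp mulmxBl mul1mx mulmxBr mulmx1 mulmxBl opprB.
set a := _ *m X; set b := X *m _; set c := a *m _.
by apply/matrixP => i j; rewrite !mxE; ring.
Qed.

Lemma PTD X Y : PT (X + Y) = PT X + PT Y.
Proof. by rewrite /PT !mulmxDr !mulmxDl opprD [X in X + _ = _]addrACA [LHS]addrACA. Qed.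

Lemma PTZ c X : PT (c *: X) = c *: PT X.
Proof. by rewrite /PT -!scalemxAr -!scalemxAl scalerBr scalerDr. Qed.

Lemma PT0 : PT 0 = 0.
Proof. by rewrite /PT !(mulmx0, mul0mx) addr0 subr0. Qed.

Lemma PTN X : PT (- X) = - PT X.
Proof. by rewrite -scaleN1r PTZ scaleN1r. Qed.

Lemma PTB X Y : PT (X - Y) = PT X - PT Y.
Proof. by rewrite PTD PTN. Qed.

Lemma PTpD X Y : PTp (X + Y) = PTp X + PTp Y.
Proof. by rewrite /PTp [_ *m (X + Y)]mulmxDr [LHS]mulmxDl. Qed.

Let PUU : PU *m PU = PU.
Proof. by rewrite /PU mulmxA -(mulmxA U) U_ortho mulmx1. Qed.

Let PVV : PV *m PV = PV.
Proof. by rewrite /PV mulmxA -(mulmxA V) V_ortho mulmx1. Qed.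

Lemma PTp_PT X : PTp (PT X) = 0.
Proof.
rewrite /PTp /PT -/PU -/PV.
have PU0 : (1%:M - PU) *m PU = 0 by rewrite mulmxBl mul1mx PUU subrr.
have PV0 : PV *m (1%:M - PV) = 0 by rewrite mulmxBr mulmx1 PVV subrr.
have -> : PU *m X + X *m PV - PU *m X *m PV = PU *m (X - X *m PV) + X *m PV.
  by rewrite mulmxBr addrAC -(mulmxA PU).
rewrite [_ *m (PU *m _ + _)]mulmxDr (mulmxA _ PU) PU0 mul0mx add0r.
by rewrite -(mulmxA (1%:M - PU)) -(mulmxA X) PV0 !mulmx0.
Qed.

Lemma PT_PT X : PT (PT X) = PT X.
Proof. by rewrite {2}[PT X]PT_PTp PTp_PT addr0. Qed.

Lemma PT_PTp0 X : PT (PTp X) = 0.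
Proof.
have -> : PTp X = X - PT X by apply/eqP; rewrite eq_sym subr_eq addrC -PT_PTp.
by rewrite PTB PT_PT subrr.
Qed.

Lemma PT_UV : PT (U *m V^T) = U *m V^T.
Proof.
rewrite /PT !mulmxA -(mulmxA U) U_ortho mulmx1.
by rewrite -(mulmxA U) V_ortho mulmx1 addrK.
Qed.

Lemma innerE X Y : inner X Y = \tr (X^T *m Y).
Proof.
rewrite /inner exchange_big /=; apply: eq_bigr => j _; rewrite mxE.
by apply: eq_bigr => i _; rewrite mxE.
Qed.

Lemma innerC X Y : inner X Y = inner Y X.
Proof. by apply: eq_bigr => i _; apply: eq_bigr => j _; rewrite mulrC. Qed.

Lemma innerDr X Y Z : inner X (Y + Z) = inner X Y + inner X Z.
Proof. by rewrite !innerE mulmxDr linearD. Qed.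

Lemma innerZr c X Y : inner X (c *: Y) = c * inner X Y.
Proof. by rewrite !innerE -scalemxAr linearZ. Qed.

Lemma innerNr X Y : inner X (- Y) = - inner X Y.
Proof. by rewrite -scaleN1r innerZr mulN1r. Qed.

Lemma innerDl X Y Z : inner (Y + Z) X = inner Y X + inner Z X.
Proof. by rewrite innerC innerDr !(innerC X). Qed.

Lemma innerNl X Y : inner (- X) Y = - inner X Y.
Proof. by rewrite innerC innerNr innerC. Qed.

Lemma inner_delta i j X : inner (delta_mx i j) X = X i j.
Proof.
rewrite /inner (bigD1 i)//= (bigD1 j)//= mxE !eqxx mul1r !big1 ?addr0//.
  by move=> k /negPf ki; apply: big1 => l _; rewrite mxE ki mul0r.
by move=> l /negPf lj; rewrite mxE lj andbF mul0r.
Qed.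

Lemma inner_PT X Y : inner (PT X) Y = inner X (PT Y).
Proof.
have PUs : PU^T = PU by rewrite trmx_mul trmxK.
have PVs : PV^T = PV by rewrite trmx_mul trmxK.
have trl A B : inner (PU *m A) B = inner A (PU *m B).
  by rewrite !innerE trmx_mul PUs mulmxA.
have trr A B : inner (A *m PV) B = inner A (B *m PV).
  by rewrite !innerE trmx_mul PVs mxtrace_mulC mulmxA mxtrace_mulC mulmxA.
rewrite /PT -/PU -/PV !innerDl !innerDr innerNl innerNr (trl X Y) (trr X Y).
by rewrite (trr (PU *m X) Y) (trl X (Y *m PV)) (mulmxA PU).
Qed.

Lemma inner_PT_PTp X Y : inner (PT X) (PTp Y) = 0.
Proof. by rewrite inner_PT PT_PTp0 innerE mulmx0 mxtrace0. Qed.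

Lemma inner_le_l1 X Y y : (forall i j, `|Y i j| <= y) ->
  `|inner X Y| <= (\sum_i \sum_j `|X i j|) * y.
Proof.
move=> Yy; apply: le_trans (ler_norm_sum _ _ _) _; rewrite mulr_suml.
apply: ler_sum => i _; apply: le_trans (ler_norm_sum _ _ _) _; rewrite mulr_suml.
by apply: ler_sum => j _; rewrite normrM ler_wpM2l.
Qed.

Lemma sqn_split k (P : 'M[F]_k) (x : 'cV_k) : P^T = P -> P *m P = P ->
  sqn x = sqn (P *m x) + sqn ((1%:M - P) *m x).
Proof.
move=> Ps PP; rewrite /sqn !trmx_mul Ps [(1%:M - P)^T]linearB /= trmx1 Ps.
have addE (A B : 'M[F]_1) : A 0 0 + B 0 0 = (A + B) 0 0 by rewrite mxE.
rewrite addE; congr (fun_of_matrix _ _ _).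
have QQ : (1%:M - P) *m (1%:M - P) = 1%:M - P.
  by rewrite mulmxBl mul1mx mulmxBr mulmx1 PP subrr subr0.
rewrite -!(mulmxA x^T) (mulmxA P) PP (mulmxA (1%:M - P)) QQ.
by rewrite -mulmxDr -mulmxDl addrC subrK mul1mx.
Qed.

(** The two summands act on orthogonal pairs of subspaces, so by Pythagoras the norm of the sum is
    governed by the larger one. *)
Lemma op_le_certificate X t : op_le X t -> t <= 1 -> op_le (U *m V^T + PTp X) 1.
Proof.
move=> hX t1 x y.
have PUs : PU^T = PU by rewrite trmx_mul trmxK.
have PVs : PV^T = PV by rewrite trmx_mul trmxK.
have AMGM k (a b : 'cV[F]_k) : 2 * (a^T *m b) 0 0 <= sqn a + sqn b.
  by have := mxtrace_gram_AMGM a b; rewrite /mxtrace !big_ord1.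
rewrite bilD mulrDr mul1r (sqn_split x PUs PUU) (sqn_split y PVs PVV) addrACA lerD//.
  have -> : bil (U *m V^T) x y = ((U^T *m x)^T *m (V^T *m y)) 0 0.
    by rewrite /bil trmx_mul trmxK !mulmxA.
  apply: le_trans (AMGM _ _ _) _; rewrite /sqn /PU /PV.
  have nrm k (A : 'M[F]_(k, r)) (z : 'cV_k) : A^T *m A = 1%:M ->
    (A^T *m z)^T *m (A^T *m z) = (A *m A^T *m z)^T *m (A *m A^T *m z).
    move=> Ao; rewrite !trmx_mul !trmxK !mulmxA -(mulmxA _ A^T A) Ao mulmx1.
    by [].
  by rewrite !nrm.
have -> : bil (PTp X) x y = bil X ((1%:M - PU) *m x) ((1%:M - PV) *m y).
  by rewrite /bil /PTp trmx_mul [(1%:M - PU)^T]linearB /= trmx1 PUs !mulmxA.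
by apply: le_trans (hX _ _) _; rewrite -[leRHS]mul1r ler_wpM2r ?addr_ge0 ?sqn_ge0.
Qed.

Lemma op_le_PTp X t : 0 <= t -> op_le X t -> op_le (PTp X) t.
Proof.
move=> t0 hX x y.
have PUs : PU^T = PU by rewrite trmx_mul trmxK.
have PVs : PV^T = PV by rewrite trmx_mul trmxK.
have -> : bil (PTp X) x y = bil X ((1%:M - PU) *m x) ((1%:M - PV) *m y).
  by rewrite /bil /PTp trmx_mul [(1%:M - PU)^T]linearB /= trmx1 PUs !mulmxA.
apply: le_trans (hX _ _) _; rewrite ler_wpM2l//.
by rewrite (sqn_split x PUs PUU) (sqn_split y PVs PVV) lerD// lerDr sqn_ge0.
Qed.

(** The left side equals [a + b - a b], with [a] and [b] the diagonal entries of the two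
    projections; the product is nonnegative. *)
Lemma PT_delta_bound rho i j : 
  (forall i, (U *m U^T) i i <= rho) -> (forall j, (V *m V^T) j j <= rho) ->
  inner (PT (delta_mx i j)) (PT (delta_mx i j)) <= 2 * rho.
Proof.
move=> hU hV; rewrite inner_PT PT_PT inner_delta /PT -/PU -/PV.
have dE k l : (delta_mx i j : 'M[F]_(n1, n2)) k l = ((k == i) && (l == j))%:R by rewrite mxE.
have dl l : (PU *m delta_mx i j) i l = PU i i * (l == j)%:R.
  rewrite mxE (bigD1 i)//= dE eqxx /= big1 ?addr0// => k /negPf ki.
  by rewrite dE ki mulr0.
have dr (A : 'M[F]_(n1, n2)) : (A *m PV) i j = \sum_k A i k * PV k j by rewrite mxE.
have diag_ge0 k (A : 'M[F]_(k, r)) l : 0 <= (A *m A^T) l l.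
  by rewrite mxE; apply: sumr_ge0 => c _; rewrite mxE -expr2 sqr_ge0.
have addE (A B : 'M[F]_(n1, n2)) : (A + B) i j = A i j + B i j by rewrite mxE.
have oppE (A : 'M[F]_(n1, n2)) : (- A) i j = - A i j by rewrite mxE.
rewrite !addE oppE dl !dr.
rewrite (bigD1 j)//= dE !eqxx mul1r big1 ?addr0; last first.
  by move=> k /negPf kj; rewrite dE kj andbF mul0r.
rewrite (bigD1 j)//= dl big1 ?addr0 ?eqxx ?mulr1; last first.
  by move=> k /negPf kj; rewrite dl kj mulr0 mul0r.
have := hU i; have := hV j; have : 0 <= PU i i * PV j j by rewrite mulr_ge0 ?diag_ge0.
rewrite -/PU -/PV; lra.
Qed.

(** The entry is an inner product of two projected basis matrices; AM-GM with both signs bounds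
    it. *)
Lemma PT_delta_entry rho i j k l :
  (forall i j, inner (PT (delta_mx i j)) (PT (delta_mx i j)) <= rho) ->
  `|PT (delta_mx i j) k l| <= rho.
Proof.
move=> h.
have -> : PT (delta_mx i j) k l = inner (PT (delta_mx k l)) (PT (delta_mx i j)).
  by rewrite inner_PT PT_PT inner_delta.
have h1 := h i j; have h2 := h k l.
have h3 := mxtrace_gram_AMGM (PT (delta_mx k l)) (PT (delta_mx i j)).
have h4 := mxtrace_gram_AMGM (PT (delta_mx k l)) (- PT (delta_mx i j)).
rewrite -!innerE ?innerNr ?innerNl ?opprK in h3 h4.
by rewrite ler_norml; apply/andP; split; lra.
Qed.

End TangentSpace.

(** * Golfing *)

Lemma Chernoff (T : finType) (g : T -> R) (rho eps : R) q :
  (0 < #|T|)%N -> (0 < q)%N -> (forall a, `|g a| <= rho) -> \sum_a g a ^+ 2 <= rho ->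
  0 < rho -> 0 < eps <= 1 ->
  Pr q (fun s => eps < #|T|%:R / q%:R * \sum_(a <- s) g a - \sum_a g a) <=
  exp (- (eps ^+ 2 * q%:R / (8 * rho * #|T|%:R))).
Proof.
move=> T0 q0 g_le g2 rho0 /andP[eps0 eps1].
have qN : q%:R != 0 :> R by rewrite pnatr_eq0 -lt0n.
have qgt0 : (0 : R) < q%:R by rewrite ltr0n.
have NN : #|T|%:R != 0 :> R by rewrite pnatr_eq0 -lt0n.
have Ngt0 : (0 : R) < #|T|%:R by rewrite ltr0n.
set N : R := #|T|%:R in NN Ngt0 *.
(* Minimizes [- la eps + 2 la^2 rho], and keeps [la |g a|] below [1/4]. *)
pose la := eps / (4 * rho).
have la0 : 0 < la by rewrite divr_gt0// mulr_gt0.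
pose m := avg g.
have mE : \sum_a g a = N * m by rewrite /m /avg mulrCA mulfV// mulr1.
have mgf : avg (fun a => exp (la * (g a - m))) <= exp (2 * la ^+ 2 * rho / N).
  have -> : 2 * la ^+ 2 * rho / N = (la * m + 2 * la ^+ 2 * rho / N) + - (la * m) by ring.
  rewrite expD [leRHS]mulrC.
  rewrite (eq_avg (h := fun a => exp (- (la * m)) * exp (la * g a))); last first.
    by move=> a; rewrite -expD mulrBr addrC.
  rewrite avgZ ler_wpM2l ?(ltW (exp_gt0 _))//.
  apply: le_trans (exp_ge1D _); rewrite addrA.
  apply: le_trans (_ : avg (fun a => 1 + la * g a + 2 * la ^+ 2 * g a ^+ 2) <= _).
    apply: le_avg => a; rewrite -(mulrA 2) -exprMn; apply: exp_le_quad.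
    rewrite normrM (gtr0_norm la0); apply: le_trans (_ : la * rho <= _).
      by rewrite ler_wpM2l// ltW.
    have -> : la * rho = eps / 4 by rewrite /la; field; rewrite gt_eqF.
    by lra.
  rewrite avgD avgD avg_cst// !avgZ lerD2l -(mulrA (2 * _)) ler_wpM2l//.
    by rewrite mulr_ge0// sqr_ge0.
  by rewrite /avg ler_wpM2r// invr_ge0 ltW.
apply: le_trans (@Markov _ q _ (fun s => exp (- (la * eps * q%:R / N)) *
     exp (\sum_(a <- s) la * (g a - m))) _ _) _.
- by move=> s; rewrite mulr_ge0// ltW// exp_gt0.
- move=> s sq; rewrite -expD mE -mulr_sumr sumrB big_const_seq count_predT iter_addr_0 sq.
  move=> h; apply: le_trans (exp_ge1D _); rewrite lerDl.
  set S := \sum_(a <- s) g a in h *.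
  have -> : - (la * eps * q%:R / N) + la * (S - m *+ q) =
     la * (q%:R / N) * ((N / q%:R * S - N * m) - eps).
    rewrite -[m *+ q]mulr_natr; clearbody la N m; field.
    by rewrite NN qN.
  by rewrite mulr_ge0 ?subr_ge0 ?(ltW h)// mulr_ge0 ?(ltW la0)// divr_ge0 ?(ltW Ngt0).
rewrite ExZ Ex_exp_sum.
apply: le_trans (_ : exp (- (la * eps * q%:R / N)) * exp (2 * la ^+ 2 * rho / N) ^+ q <= _).
  rewrite ler_wpM2l ?(ltW (exp_gt0 _))// lerXn2r// nnegrE ?(ltW (exp_gt0 _))//.
  by rewrite divr_ge0// sumr_ge0// => a _; rewrite ltW// exp_gt0.
rewrite -exp_natM -expD; apply: ler_exp; rewrite le_eqVlt; apply/orP; left; apply/eqP.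
by rewrite /la; field; rewrite NN gt_eqF.
Qed.

Section Golfing.
Variables (n1 n2 r : nat).
Hypotheses (n1_gt0 : (0 < n1)%N) (n2_gt0 : (0 < n2)%N).
Variables (U : 'M[R]_(n1, r)) (V : 'M[R]_(n2, r)).
Hypotheses (U_ortho : U^T *m U = 1%:M) (V_ortho : V^T *m V = 1%:M).
Notation T := ('I_n1 * 'I_n2)%type.
Notation M := 'M[R]_(n1, n2).
Notation N := (n1 * n2)%N.
Notation PT := (PT U V).
Notation PTp := (PTp U V).
Variable rho : R.
Hypotheses (rho_gt0 : 0 < rho)
  (rho_bound : forall i j, inner (PT (delta_mx i j)) (PT (delta_mx i j)) <= rho).

Lemma innerE_pair (X Y : M) : inner X Y = \sum_(a : T) X a.1 a.2 * Y a.1 a.2.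
Proof. by rewrite /inner pair_bigA. Qed.

Lemma PT_sampE q s (W : M) i j :
  PT (W - samp q s W) i j = \sum_(a : T) PT (delta_mx i j) a.1 a.2 * W a.1 a.2 -
    N%:R / q%:R * \sum_(a <- s) PT (delta_mx i j) a.1 a.2 * W a.1 a.2.
Proof.
rewrite -inner_delta -inner_PT innerDr innerNr innerE_pair; congr (_ - _).
rewrite /samp mulr_sumr.
elim: s => [|a s IH]; first by rewrite !big_nil innerE mulmx0 mxtrace0.
rewrite !big_cons innerDr IH innerZr (innerC _ (delta_mx _ _)) inner_delta.
by congr (_ + _); rewrite -[LHS]mulrA; congr (_ * _); rewrite mulrC.
Qed.

(** An entry of the error is a scalar sum, by self-adjointness of [PT]. The single bound [rho]
    controls both the size of its terms and their sum of squares; the union runs over the entries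
    and the two signs. *)
Lemma Pr_samp_sup q (W : M) (w eps : R) : (0 < q)%N -> 0 < w -> (forall i j, `|W i j| <= w) ->
  0 < eps <= 1 ->
  Pr q (fun s => ~ forall i j, `|PT (W - samp q s W) i j| <= eps * w) <=
  N%:R * (2 * exp (- (eps ^+ 2 * q%:R / (8 * rho * N%:R)))).
Proof.
move=> q0 w0 Ww eps01; have T0 := entries_gt0 n1_gt0 n2_gt0.
have qN : q%:R != 0 :> R by rewrite pnatr_eq0 -lt0n.
rewrite -card_entries.
apply: le_trans (_ : Pr q (fun s => exists a : T,
   ~ `|PT (W - samp q s W) a.1 a.2| <= eps * w) <= _).
  apply: le_Pr => s _ h; apply: contrapT => nex; apply: h => i j.
  by apply: contrapT => h; apply: nex; exists (i, j).
apply: Pr_exists => -[i j] /=.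
pose g (a : T) := PT (delta_mx i j) a.1 a.2 * (W a.1 a.2 / w).
have W1 a : `|W a.1 a.2 / w| <= 1.
  by rewrite normrM normfV (gtr0_norm w0) ler_pdivrMr// mul1r.
have g_le a : `|g a| <= rho.
  rewrite /g normrM -[leRHS]mulr1; apply: ler_pM => //.
  exact: PT_delta_entry.
have g2 : \sum_a g a ^+ 2 <= rho.
  apply: le_trans (rho_bound i j); rewrite innerE_pair; apply: ler_sum => a _.
  rewrite -expr2 /g exprMn ler_piMr ?sqr_ge0//.
  by rewrite -[leLHS]ger0_norm ?sqr_ge0// normrX exprn_ile1.
have PTE s : PT (W - samp q s W) i j =
    - w * (#|{: T}|%:R / q%:R * \sum_(a <- s) g a - \sum_a g a).
  rewrite PT_sampE card_entries mulNr -mulrN opprB mulrBr; congr (_ - _).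
    by rewrite mulr_sumr; apply: eq_bigr => a _; rewrite /g; field; rewrite gt_eqF.
  rewrite [RHS]mulrCA; congr (_ * _).
  by rewrite mulr_sumr; apply: eq_bigr => a _; rewrite /g; field; rewrite gt_eqF.
set e := exp _.
apply: le_trans (_ : Pr q (fun s =>
   (eps < #|{: T}|%:R / q%:R * \sum_(a <- s) g a - \sum_a g a) \/
   (eps < #|{: T}|%:R / q%:R * \sum_(a <- s) (- g a) - \sum_a (- g a))) <= _).
  apply: le_Pr => s _ /negP; rewrite -ltNge PTE normrM normrN (gtr0_norm w0).
  rewrite [w * _]mulrC ltr_pM2r//.
  rewrite !sumrN mulrN; set d := _ - _.
  have -> : forall x y : R, - x - - y = - (x - y) by move=> x y; ring.
  rewrite -/d; have [d0|d0] := lerP 0 d; first by rewrite ger0_norm//; left.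
  by rewrite ltr0_norm//; right.
apply: le_trans (Pr_or _ _ _) _; rewrite [leRHS]mulr_natl mulr2n lerD//.
  exact: Chernoff.
apply: Chernoff => //; first by move=> a; rewrite normrN.
by under eq_bigr do rewrite sqrrN.
Qed.

Definition l1norm (X : M) : R := \sum_i \sum_j `|X i j|.

Lemma l1normD (X Y : M) : l1norm (X + Y) <= l1norm X + l1norm Y.
Proof.
rewrite /l1norm -big_split; apply: ler_sum => i _; rewrite -big_split; apply: ler_sum => j _.
by rewrite mxE ler_normD.
Qed.

Lemma l1norm_samp q s (W : M) (w : R) : (0 < q)%N -> size s = q ->
  (forall i j, `|W i j| <= w) -> l1norm (samp q s W) <= N%:R * w.
Proof.
move=> q0 sq Ww.
have qN : q%:R != 0 :> R by rewrite pnatr_eq0 -lt0n.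
have -> : N%:R * w = (size s)%:R * (N%:R / q%:R * w) by rewrite sq; field.
rewrite /samp; elim: s {sq} => [|a s IH].
  rewrite big_nil mul0r /l1norm big1// => i _; rewrite big1// => j _.
  by rewrite mxE normr0.
rewrite big_cons; apply: le_trans (l1normD _ _) _.
rewrite /= -natr1 mulrDl mul1r addrC lerD//.
set c := _ * W _ _; rewrite /l1norm.
have dE i j : (c *: delta_mx a.1 a.2 : M) i j = c * ((i == a.1) && (j == a.2))%:R.
  by rewrite !mxE.
rewrite (bigD1 a.1)//= (bigD1 a.2)//= dE !eqxx mulr1 !big1 ?addr0.
- by rewrite normrM ger0_norm ?divr_ge0// ler_wpM2l ?divr_ge0.
- by move=> i /negPf ia; apply: big1 => j _; rewrite dE ia mulr0 normr0.
- by move=> j /negPf ja; rewrite dE ja andbF mulr0 normr0.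
Qed.

Lemma samp_support q s (W : M) i j : (i, j) \notin s -> samp q s W i j = 0.
Proof.
rewrite /samp; elim: s => [|[k l] s IH]; first by rewrite big_nil mxE.
rewrite in_cons negb_or big_cons mxE => /andP[ijkl /IH ->]; rewrite !mxE addr0 /=.
move: ijkl; rewrite xpair_eqE; case: (i == k) => /=; last by rewrite mulr0.
by move/negPf->; rewrite mulr0.
Qed.

(* Approximate dual certificate for [W] after [L] batches of size [q]: [Y] is supported on the
   sample [s], and [W'] is what remains of [W] on the tangent space. *)
Record golf_cert (L q : nat) (eps tau : R) (W : M) (w : R) (s : seq T) (Y W' : M) : Prop :=
  GolfCert {
    cert_support : forall i j, (i, j) \notin s -> Y i j = 0;
    cert_l1 : l1norm Y <= L%:R * N%:R * w;
    cert_PT : PT Y = W - W';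
    cert_residual_PT : PT W' = W';
    cert_residual : forall i j, `|W' i j| <= eps ^+ L * w;
    cert_op : op_le (PTp Y) (L%:R * (N%:R / q%:R * w * tau)) }.

Variables (q p : nat) (eps tau kappa : R).
Hypotheses (eps01 : 0 < eps <= 1) (tau_gt0 : 0 < tau) (q_gt0 : (0 < q)%N) (p_gt0 : (0 < p)%N).
Hypotheses (k1 : n1%:R^-1 <= kappa) (k2 : n2%:R^-1 <= kappa).
Hypotheses (qk : 2 * p%:R <= q%:R * kappa)
  (tau_big : 8 * exp 4 * p%:R * (q%:R * kappa) <= tau ^+ 2).

Definition batch_fail : R :=
  N%:R * (2 * exp (- (eps ^+ 2 * q%:R / (8 * rho * N%:R)))) + (n1 + n2)%:R * exp (- p%:R).

Lemma batch_fail_ge0 : 0 <= batch_fail.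
Proof. by rewrite /batch_fail addr_ge0// !mulr_ge0// ltW// exp_gt0. Qed.

(** The residual after the first batch depends on that batch alone, so for the later, independent
    batches it is again a fixed starting matrix, with sup norm bound [eps * w]. *)
Lemma Pr_golf L (W : M) (w : R) : PT W = W -> 0 < w -> (forall i j, `|W i j| <= w) ->
  Pr (L * q) (fun s => ~ exists Y W', golf_cert L q eps tau W w s Y W') <= L%:R * batch_fail.
Proof.
have T0 := entries_gt0 n1_gt0 n2_gt0.
have /andP[eps0 eps1] := eps01.
elim: L W w => [|L IH] W w PTW w0 Ww.
  rewrite mul0r -(Ex_cst (R := R) T0 (0 * q) 0); apply: le_Ex => s _.
  rewrite lern0 eqb0; apply/asboolPn; apply; exists 0, W; split.
  - by move=> i j _; rewrite mxE.
  - by rewrite !mul0r /l1norm big1// => i _; rewrite big1// => j _; rewrite mxE normr0.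
  - by rewrite subrr PT0.
  - exact: PTW.
  - by move=> i j; rewrite expr0 mul1r.
  - by move=> x y; rewrite /bil /PTp mulmx0 mul0mx mulmx0 mul0mx mxE mulr0 !mul0r.
rewrite mulSn -natr1 mulrDl mul1r addrC.
pose Q1 s := ~ forall i j, `|PT (W - samp q s W) i j| <= eps * w.
pose Q2 s := ~ op_le (samp q s W - W) (N%:R / q%:R * w * tau).
have QE : Pr q (fun s => Q1 s \/ Q2 s) <= batch_fail.
  apply: le_trans (Pr_or _ _ _) _; rewrite lerD ?Pr_samp_sup//.
  exact: (Pr_samp_op n1_gt0 n2_gt0 w0 Ww k1 k2).
have bf0 : 0 <= L%:R * batch_fail by rewrite mulr_ge0// batch_fail_ge0.
apply: le_trans (Pr_cat T0 (Q := fun s => Q1 s \/ Q2 s) bf0 _) _; last by rewrite lerD2r.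
move=> s1 sq /not_orP[/contrapT sup1 /contrapT op1].
pose W1 := PT (W - samp q s1 W).
have ew0 : 0 < eps * w by rewrite mulr_gt0.
have ew : eps * w <= w by rewrite ler_piMl// ltW.
apply: le_trans (IH W1 (eps * w) (PT_PT U_ortho V_ortho _) ew0 sup1).
apply: le_Pr => s2 _; apply: contra_not => -[Y [W' [supp l1 hPT resPT res op]]].
exists (samp q s1 W + Y), W'; split.
- move=> i j; rewrite mem_cat negb_or mxE => /andP[h1 h2].
  by rewrite samp_support// supp// addr0.
- apply: le_trans (l1normD _ _) _; rewrite -natr1 mulrDl mul1r mulrDl addrC lerD//.
    by apply: le_trans l1 _; rewrite ler_wpM2l// mulr_ge0.
  exact: l1norm_samp.
- by rewrite PTD hPT /W1 PTB PTW addrA [_ + (W - _)]addrC subrK.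
- exact: resPT.
- by move=> i j; apply: le_trans (res i j) _; rewrite exprSr mulrA.
(* [W] lies in the tangent space, so subtracting it does not change the orthogonal component and
   exposes the centred error. *)
- have -> : PTp (samp q s1 W + Y) = PTp (samp q s1 W - W) + PTp Y.
    have NW : - W = PT (- W) by rewrite PTN PTW.
    by rewrite -PTpD addrAC [RHS]PTpD NW PTp_PT// addr0.
  have c0 : 0 <= N%:R / q%:R * w * tau.
    by rewrite !mulr_ge0 ?invr_ge0// ltW.
  apply: op_le_trans (op_leD (op_le_PTp U_ortho V_ortho c0 op1) op) _.
  rewrite -natr1 mulrDl mul1r addrC lerD2r ler_wpM2l//.
  by rewrite ler_wpM2r ?(ltW tau_gt0)// ler_wpM2l// divr_ge0.
Qed.

End Golfing.

(** * Dual certificates *)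

Section DualCertificate.
Variables (n1 n2 r : nat).
Hypotheses (n1_gt0 : (0 < n1)%N) (n2_gt0 : (0 < n2)%N).
Variables (U : 'M[R]_(n1, r)) (V : 'M[R]_(n2, r)).
Hypotheses (U_ortho : U^T *m U = 1%:M) (V_ortho : V^T *m V = 1%:M).
Notation T := ('I_n1 * 'I_n2)%type.
Notation M := 'M[R]_(n1, n2).
Notation N := (n1 * n2)%N.
Notation PT := (PT U V).
Notation PTp := (PTp U V).

Lemma PTpZ c (X : M) : PTp (c *: X) = c *: PTp X.
Proof. by rewrite /PTp -scalemxAr -scalemxAl. Qed.

Lemma PTp_PTp (X : M) : PTp (PTp X) = PTp X.
Proof. by rewrite [X in RHS](PT_PTp U V) PTpD PTp_PT// add0r. Qed.

Lemma op_le_sup (X : M) (z : R) nn : (n1 <= nn)%N -> (n2 <= nn)%N ->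
  0 <= z -> (forall i j, `|X i j| <= z) -> op_le X (nn%:R * z).
Proof.
move=> n1n n2n z0 Xz x y.
have sqnE k (u : 'cV[R]_k) : sqn u = \sum_i u i 0 ^+ 2.
  by rewrite /sqn mxE; apply: eq_bigr => i _; rewrite mxE expr2.
have -> : bil X x y = \sum_i \sum_j X i j * x i 0 * y j 0.
  rewrite /bil mxE exchange_big /=; apply: eq_bigr => j _; rewrite mxE mulr_suml.
  by apply: eq_bigr => i _; rewrite mxE mulrC [x _ _ * _]mulrC mulrC.
apply: le_trans (_ : \sum_i \sum_j z * (x i 0 ^+ 2 + y j 0 ^+ 2) <= _).
  rewrite mulr_sumr; apply: ler_sum => i _; rewrite mulr_sumr; apply: ler_sum => j _.
  have := Xz i j; rewrite ler_norml => /andP[h1 h2].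
  have := sqr_ge0 (x i 0 + y j 0); have := sqr_ge0 (x i 0 - y j 0).
  by move: (X i j) (x i 0) (y j 0) h1 h2 => c a b; nra.
have -> : \sum_i \sum_j z * (x i 0 ^+ 2 + y j 0 ^+ 2) = z * (n2%:R * sqn x + n1%:R * sqn y).
  rewrite !sqnE; under eq_bigr do rewrite -mulr_sumr big_split /= sumr_const card_ord.
  rewrite -mulr_sumr big_split /= sumr_const card_ord sumrMnl.
  by rewrite [n2%:R * _]mulr_natl [n1%:R * _]mulr_natl.
rewrite [nn%:R * z]mulrC -mulrA ler_wpM2l// mulrDr.
by rewrite lerD// ler_wpM2r ?sqn_ge0// ler_nat.
Qed.

Lemma exists_sup (X : M) : exists i j, forall k l, `|X k l| <= `|X i j|.
Proof.
pose a0 : T := (Ordinal n1_gt0, Ordinal n2_gt0).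
case: (@Order.TotalTheory.arg_maxP _ _ T a0 xpredT (fun a => `|X a.1 a.2|) erefl) => -[i j] _ h.
by exists i, j => k l; apply: (h (k, l)).
Qed.

Variables (L q nn : nat) (eps tau w0 : R) (s : seq T) (Y0 W0 : M).
Hypotheses (n1_le : (n1 <= nn)%N) (n2_le : (n2 <= nn)%N).
Hypotheses (w0_ge0 : 0 <= w0 <= 1) (eps_ge0 : 0 <= eps).
Hypothesis cert0 : golf_cert U V L q eps tau (U *m V^T) w0 s Y0 W0.
Hypothesis certs : forall i j, exists Y W', golf_cert U V L q eps tau (PT (delta_mx i j)) 1 s Y W'.
Hypothesis op_small : L%:R * (N%:R / q%:R * w0 * tau) <= 2^-1.
Hypothesis eps_small : 4 * L%:R * nn%:R * N%:R ^+ 2 * eps ^+ L < 1.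
Hypothesis eps_small2 : N%:R * eps ^+ L <= 2^-1.

Lemma inner_disjoint (Y Z : M) : (forall i j, (i, j) \notin s -> Y i j = 0) ->
  (forall i j, (i, j) \in s -> Z i j = 0) -> inner Y Z = 0.
Proof.
move=> hY hZ; rewrite /inner big1// => i _; rewrite big1// => j _.
by have [/hZ ->|/hY ->] := boolP ((i, j) \in s); rewrite ?mulr0 ?mul0r.
Qed.

Lemma l1norm_le (X : M) (x : R) : (forall i j, `|X i j| <= x) -> l1norm X <= N%:R * x.
Proof.
move=> Xx; apply: le_trans (_ : \sum_(i < n1) \sum_(j < n2) x <= _).
  by apply: ler_sum => i _; apply: ler_sum.
by rewrite !sumr_const !card_ord -mulrnA mulr_natl mulnC.
Qed.

(* The certificates [Y] of the [PT (delta_mx i j)] bound [PT Z] by [PTp Z] in the sup norm for every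
   [Z] vanishing on the sample, as [Y] is orthogonal to [Z]; this replaces the usual operator
   concentration on the tangent space. *)
Lemma exists_dual_certificate (Z : M) : (forall i j, (i, j) \in s -> Z i j = 0) -> Z != 0 ->
  exists X : M, op_le (U *m V^T + PTp X) 1 /\ 0 < inner (U *m V^T + PTp X) Z.
Proof.
move=> Zs Z0; have /andP[w00 w01] := w0_ge0.
have [i0 [j0 zmax]] := exists_sup (PTp Z); set z : R := `|_| in zmax.
have [i1 [j1 ymax]] := exists_sup (PT Z); set y : R := `|_| in ymax.
have z0 : 0 <= z by rewrite normr_ge0.
have y0 : 0 <= y by rewrite normr_ge0.
have residual (W' : M) c : PT W' = W' -> (forall i j, `|W' i j| <= eps ^+ L * c) -> 0 <= c <= 1 ->
    `|inner W' Z| <= N%:R * eps ^+ L * y.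
  move=> PTW W'c /andP[c0 c1]; rewrite -PTW inner_PT//.
  apply: le_trans (inner_le_l1 _ ymax) _; rewrite ler_wpM2r//.
  apply: le_trans (l1norm_le W'c) _; rewrite ler_wpM2l// ler_piMr// exprn_ge0//.
have yz : y <= 2 * (L%:R * N%:R) * z.
  have [Y [W' [supp l1 hPT resPT res _]]] := certs i1 j1.
  have E : PT Z i1 j1 = - inner Y (PTp Z) + inner W' Z.
    rewrite -inner_delta -inner_PT// -[PT (delta_mx _ _)](subrK W') -hPT innerDl inner_PT//.
    congr (_ + _).
    have -> : PT Z = Z - PTp Z by rewrite {2}(PT_PTp U V Z) addrK.
    by rewrite innerDr innerNr (inner_disjoint supp Zs) add0r.
  have h1 : `|inner W' Z| <= N%:R * eps ^+ L * y by apply: residual res _; rewrite ?ler01 ?lexx.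
  have h2 : `|inner Y (PTp Z)| <= L%:R * N%:R * z.
    by apply: le_trans (inner_le_l1 _ zmax) _; rewrite ler_wpM2r// (le_trans l1)// mulr1.
  have : y <= L%:R * N%:R * z + 2^-1 * y.
    rewrite {1}/y E; apply: le_trans (ler_normD _ _) _; rewrite normrN lerD//.
    by apply: le_trans h1 _; rewrite ler_wpM2r.
  lra.
(* If [PTp Z] vanished, [yz] would make [PT Z], hence [Z], vanish. *)
have zgt0 : 0 < z.
  rewrite lt0r z0 andbT; apply: contra Z0 => /eqP zE.
  have yE : y = 0 by apply/eqP; rewrite eq_le y0 andbT; move: yz; rewrite zE mulr0.
  rewrite (PT_PTp U V Z); apply/eqP/matrixP => i j.
  rewrite [(PT Z + PTp Z) i j]mxE [RHS]mxE.
  have := ymax i j; rewrite yE normr_le0 => /eqP ->.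
  by have := zmax i j; rewrite zE normr_le0 => /eqP ->; rewrite addr0.
have nn0 : (0 < nn)%N by apply: leq_trans n1_le.
have nngt0 : (0 : R) < nn%:R by rewrite ltr0n.
(* The unit norm is shared equally: [la *: PTp Z] takes one half, and [op_small] grants the other
   half to [PTp Y0]. *)
pose la : R := (2 * (nn%:R * z))^-1.
have la0 : 0 <= la by rewrite invr_ge0 !mulr_ge0.
exists (PTp Y0 + la *: PTp Z); split.
  have opZ := op_leZ la0 (op_le_sup n1_le n2_le z0 zmax).
  apply: (op_le_certificate U_ortho V_ortho (op_leD (cert_op cert0) opZ)).
  have -> : la * (nn%:R * z) = 2^-1 by rewrite /la; field; rewrite !gt_eqF.
  by apply: le_trans (lerD op_small (lexx _)) _; lra.
have [supp _ hPT resPT res _] := cert0.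
(* Because [PT Y0] is [U *m V^T - W0]. As [Y0] is orthogonal to [Z], only the residual [W0] and the
   gain [la *: PTp Z] remain. *)
have -> : U *m V^T + PTp (PTp Y0 + la *: PTp Z) = Y0 + (W0 + la *: PTp Z).
  rewrite PTpD PTpZ !PTp_PTp addrA [in RHS]addrA; congr (_ + _).
  by rewrite [in RHS](PT_PTp U V Y0) hPT addrAC subrK.
rewrite innerDl (inner_disjoint supp Zs) add0r innerDl.
have h1 : `|inner W0 Z| <= N%:R * eps ^+ L * y by apply: residual res _.
have h2 : z / (2 * nn%:R) <= inner (la *: PTp Z) Z.
  rewrite innerC innerZr innerC.
  have -> : inner (PTp Z) Z = inner (PTp Z) (PTp Z).
    by rewrite {2}(PT_PTp U V Z) innerDr innerC inner_PT_PTp// add0r.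
  have -> : z / (2 * nn%:R) = la * z ^+ 2 by rewrite /la; field; rewrite !gt_eqF.
  rewrite ler_wpM2l// /inner (bigD1 i0)//= (bigD1 j0)//= -expr2.
  rewrite /z real_normK ?num_real// -addrA lerDl addr_ge0// sumr_ge0// => i _.
    by rewrite -expr2 sqr_ge0.
  by apply: sumr_ge0 => j _; rewrite -expr2 sqr_ge0.
have h3 : N%:R * eps ^+ L * y < z / (2 * nn%:R).
  rewrite ltr_pdivlMr ?mulr_gt0//.
  apply: le_lt_trans (_ : z * (4 * L%:R * nn%:R * N%:R ^+ 2 * eps ^+ L) < _); last first.
    by rewrite -[ltRHS]mulr1 ltr_pM2l.
  have c0 : 0 <= N%:R * eps ^+ L * (2 * nn%:R) by rewrite !mulr_ge0// exprn_ge0.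
  by have := ler_wpM2l c0 yz; lra.
by move: h1; rewrite ler_norml => /andP[h1 _]; lra.
Qed.

End DualCertificate.

(** [X] may depend on [Z]; the displayed sums are subgradients of the nuclear norm at a matrix with
    singular vectors [U] and [V]. *)
Definition dual_certifiable n1 n2 r (U : 'M[R]_(n1, r)) (V : 'M[R]_(n2, r))
    (O : pred ('I_n1 * 'I_n2)) : Prop :=
  forall Z : 'M[R]_(n1, n2), (forall i j, O (i, j) -> Z i j = 0) -> Z != 0 ->
  exists X, op_le (U *m V^T + PTp U V X) 1 /\ 0 < inner (U *m V^T + PTp U V X) Z.

(** All [n1 n2 + 1] golfing runs use the same sample; a union bound makes them succeed together. *)
Lemma Pr_dual_certifiable n1 n2 r (U : 'M[R]_(n1, r)) (V : 'M[R]_(n2, r))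
    (L q p nn : nat) (rho eps tau kappa w0 : R) :
  (0 < n1 <= nn)%N -> (0 < n2 <= nn)%N -> U^T *m U = 1%:M -> V^T *m V = 1%:M ->
  0 < rho <= 1 -> (forall i, (U *m U^T) i i <= rho / 2) -> (forall j, (V *m V^T) j j <= rho / 2) ->
  0 < w0 <= 1 -> (forall i j, `|(U *m V^T) i j| <= w0) ->
  0 < eps <= 1 -> 0 < tau -> (0 < q)%N -> (0 < p)%N ->
  n1%:R^-1 <= kappa -> n2%:R^-1 <= kappa -> 2 * p%:R <= q%:R * kappa ->
  8 * exp 4 * p%:R * (q%:R * kappa) <= tau ^+ 2 ->
  L%:R * ((n1 * n2)%:R / q%:R * w0 * tau) <= 2^-1 ->
  4 * L%:R * nn%:R * (n1 * n2)%:R ^+ 2 * eps ^+ L < 1 -> (n1 * n2)%:R * eps ^+ L <= 2^-1 ->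
  Pr (L * q) (fun s => ~ dual_certifiable U V (fun a => a \in s)) <=
  (n1 * n2).+1%:R * (L%:R * batch_fail n1 n2 rho q p eps).
Proof.
move=> /andP[n10 n1n] /andP[n20 n2n] Uo Vo /andP[rho0 rho1] hU hV
  /andP[w00 w01] UVw eps01 tau0 q0 p0 k1 k2 qk htau hop he he2.
have /andP[eps0 _] := eps01.
have rho_bound i j : inner (PT U V (delta_mx i j)) (PT U V (delta_mx i j)) <= rho.
  by apply: le_trans (PT_delta_bound Uo Vo i j hU hV) _; lra.
pose cert W w s := exists Y W', golf_cert U V L q eps tau W w s Y W'.
apply: le_trans (_ : Pr (L * q) (fun s => ~ cert (U *m V^T) w0 s \/
   exists a : 'I_n1 * 'I_n2, ~ cert (PT U V (delta_mx a.1 a.2)) 1 s) <= _).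
  apply: le_Pr => s _ bad; apply: contrapT => /not_orP[/contrapT[Y0 [W0 c0]] /forallNP cs].
  apply: bad => Z Zs Z0.
  apply: (exists_dual_certificate n10 n20 Uo Vo n1n n2n _ _ c0 _ hop he he2 Zs Z0).
  - by rewrite (ltW w00).
  - exact: ltW.
  - by move=> i j; have /contrapT := cs (i, j).
have golf := Pr_golf n10 n20 Uo Vo rho0 rho_bound eps01 tau0 q0 p0 k1 k2 qk htau.
apply: le_trans (Pr_or _ _ _) _; rewrite -natr1 mulrDl mul1r addrC lerD//.
  rewrite -(card_entries n1 n2); apply: Pr_exists => -[i j] /=.
  apply: golf => //.
  - exact: PT_PT.
  - by move=> k l; apply: le_trans (PT_delta_entry Uo Vo i j k l rho_bound) rho1.
by apply: golf => //; apply: PT_UV.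
Qed.

(** * Nuclear norm *)

Section MatrixForm.

Definition basis_mx d r (w : 'I_r -> vec d) : 'M[R]_(d, r) := \matrix_(i, k) w k i.
Definition entries_mx n1 n2 (X : mat n1 n2) : 'M[R]_(n1, n2) := \matrix_(i, j) X i j.

Lemma basis_mx_ortho d r (w : 'I_r -> vec d) : orthonormal w ->
  (basis_mx w)^T *m basis_mx w = 1%:M.
Proof.
move=> wo; apply/matrixP => k l; rewrite !mxE.
transitivity (dot (w k) (w l)); last by rewrite wo; case: eqP.
by rewrite /dot; apply: eq_bigr => i _; rewrite !mxE.
Qed.

Lemma svd_mxE n1 n2 r (s : 'I_r -> R) (a : 'I_r -> vec n1) (b : 'I_r -> vec n2) :
  entries_mx (svd_mat s a b) =
  \sum_k s k *: (col k (basis_mx a) *m (col k (basis_mx b))^T).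
Proof.
apply/matrixP => i j; rewrite mxE summxE; apply: eq_bigr => k _.
by rewrite !mxE big_ord1 !mxE mulrA.
Qed.

Lemma inner_rank1 n1 n2 (Q : 'M[R]_(n1, n2)) x y : inner Q (x *m y^T) = bil Q x y.
Proof.
rewrite innerC innerE trmx_mul trmxK -mulmxA mxtrace_mulC.
by rewrite /mxtrace big_ord1.
Qed.

Lemma inner_svd n1 n2 r (Q : 'M[R]_(n1, n2)) (s : 'I_r -> R) a b :
  inner Q (entries_mx (svd_mat s a b)) =
  \sum_k s k * bil Q (col k (basis_mx a)) (col k (basis_mx b)).
Proof.
rewrite svd_mxE.
rewrite (big_morph (inner Q) (innerDr Q) (_ : inner Q 0 = 0)).
  by apply: eq_bigr => k _; rewrite innerZr inner_rank1.
by rewrite innerE mulmx0 mxtrace0.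
Qed.

Lemma bil_col n1 n2 r (Q : 'M[R]_(n1, n2)) (U : 'M[R]_(n1, r)) (V : 'M[R]_(n2, r)) k l :
  bil Q (col k U) (col l V) = (U^T *m Q *m V) k l.
Proof.
rewrite /bil !colE trmx_mul trmx_delta !mulmxA -(mulmxA _ U^T) -(mulmxA _ (_ *m Q)).
by rewrite -rowE -colE !mxE.
Qed.

Lemma sqn_col d r (U : 'M[R]_(d, r)) k : U^T *m U = 1%:M -> sqn (col k U) = 1.
Proof. by move=> Uo; have := bil_col 1%:M U U k k; rewrite /bil /sqn !mulmx1 Uo !mxE eqxx. Qed.

Lemma bil_certificate n1 n2 r (U : 'M[R]_(n1, r)) (V : 'M[R]_(n2, r)) X k :
  U^T *m U = 1%:M -> V^T *m V = 1%:M ->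
  bil (U *m V^T + PTp U V X) (col k U) (col k V) = 1.
Proof.
move=> Uo Vo; rewrite bil_col mulmxDr mulmxDl.
have -> : U^T *m PTp U V X = 0.
  have h : U^T *m (1%:M - U *m U^T) = 0.
    by rewrite mulmxBr mulmx1 mulmxA Uo mul1mx subrr.
  by rewrite /PTp !(mulmxA U^T) h !mul0mx.
by rewrite mul0mx addr0 mulmxA Uo mul1mx Vo mxE eqxx.
Qed.

Lemma nuclear_norm_ge n1 n2 (X : mat n1 n2) t (Q : 'M[R]_(n1, n2)) :
  nuclear_norm_is X t -> op_le Q 1 -> inner Q (entries_mx X) <= t.
Proof.
move=> [r [s [a [b [[s0 [ao [bo XE]]] ->]]]]] hQ.
have -> : entries_mx X = entries_mx (svd_mat s a b).
  by apply/matrixP => i j; rewrite !mxE XE.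
rewrite inner_svd; apply: ler_sum => k _.
rewrite -[leRHS]mulr1 ler_wpM2l//; first by apply/ltW/RltP.
have := hQ (col k (basis_mx a)) (col k (basis_mx b)).
by rewrite !sqn_col ?basis_mx_ortho//; lra.
Qed.

Lemma inner_svd_certificate n1 n2 r (s : 'I_r -> R) (u : 'I_r -> vec n1) (v : 'I_r -> vec n2) X :
  orthonormal u -> orthonormal v ->
  inner (basis_mx u *m (basis_mx v)^T + PTp (basis_mx u) (basis_mx v) X)
    (entries_mx (svd_mat s u v)) = \sum_k s k.
Proof.
move=> uo vo; rewrite inner_svd; apply: eq_bigr => k _.
by rewrite bil_certificate ?basis_mx_ortho// mulr1.
Qed.

(** The value [t] may come from another decomposition of the same matrix. The certificate of that
    one attains [t], and paired with the present one it gives at most [\sum_k s k]. *)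
Lemma nuclear_norm_svd_le n1 n2 r (s : 'I_r -> R) (u : 'I_r -> vec n1) (v : 'I_r -> vec n2) t :
  (forall k, 0 < s k) -> orthonormal u -> orthonormal v ->
  nuclear_norm_is (svd_mat s u v) t -> t <= \sum_k s k.
Proof.
move=> s0 uo vo [r' [s' [a [b [[s'0 [ao [bo ME]]] ->]]]]].
have -> : \big[Rplus/0]_(k < r') s' k = \sum_k s' k by [].
rewrite -(inner_svd_certificate s' 0 ao bo).
have -> : entries_mx (svd_mat s' a b) = entries_mx (svd_mat s u v).
  by apply/matrixP => i j; rewrite !mxE ME.
apply: nuclear_norm_ge.
  by exists r, s, u, v; split=> //; split=> // k; apply/RltP.
have op0 : op_le (0 : 'M[R]_(n1, n2)) 0.
  by move=> x y; rewrite /bil mulmx0 mul0mx mxE mulr0 mul0r.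
exact: (op_le_certificate (basis_mx_ortho ao) (basis_mx_ortho bo) op0 ler01).
Qed.

(** With [Q] the certificate for [Z = X - M]: [tM <= <Q, M> = <Q, X> - <Q, Z> < <Q, X> <= tX]. *)
Lemma dual_certifiable_unique n1 n2 r (Om : {set 'I_n1 * 'I_n2}) (s : 'I_r -> R)
    (u : 'I_r -> vec n1) (v : 'I_r -> vec n2) :
  (forall k, 0 < s k) -> orthonormal u -> orthonormal v ->
  dual_certifiable (basis_mx u) (basis_mx v) (fun a => a \in Om) ->
  unique_nuc_minimizer Om (svd_mat s u v).
Proof.
move=> s0 uo vo dual X feas [i0 [j0 neq]] tX tM hX hM; apply/RltP.
pose Z := entries_mx X - entries_mx (svd_mat s u v).
have Zs i j : (i, j) \in Om -> Z i j = 0.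
  by move=> ij; rewrite !mxE feas// subrr.
have Z0 : Z != 0.
  by apply/eqP => /matrixP /(_ i0 j0); rewrite !mxE => /eqP; rewrite subr_eq0 => /eqP.
have [Q [opQ posQ]] := dual Z Zs Z0.
apply: le_lt_trans (nuclear_norm_svd_le s0 uo vo hM) _.
apply: lt_le_trans (nuclear_norm_ge hX opQ).
by rewrite -(inner_svd_certificate s Q uo vo) -subr_gt0 -innerNr -innerDr.
Qed.

(** Rank zero is kept apart because coherence divides by [r]. Here the target is zero, and any other
    [X] has a positive singular value. *)
Lemma unique_rank0 n1 n2 (Om : {set 'I_n1 * 'I_n2}) (s : 'I_0 -> R) u v :
  unique_nuc_minimizer Om (svd_mat (n1 := n1) (n2 := n2) s u v).
Proof.
move=> X _ [i0 [j0 neq]] tX tM hX hM; apply/RltP.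
have tM0 : tM <= 0.
  by have := nuclear_norm_svd_le (s := s) (u := u) (v := v) _ _ _ hM; rewrite big_ord0; apply=> -[].
apply: le_lt_trans tM0 _.
move: hX => [[|r] [a [b [c [[a0 [_ [_ XE]]] ->]]]]].
  by case: neq; rewrite XE /svd_mat !big_ord0.
rewrite big_ord_recl; apply: ltr_pwDl; first exact/RltP.
by apply: (@sumr_ge0 R) => k _; apply/ltW/RltP.
Qed.

Lemma unique_nuc_minimizer_sub n1 n2 (Om Om' : {set 'I_n1 * 'I_n2}) (M : mat n1 n2) :
  Om \subset Om' -> unique_nuc_minimizer Om M -> unique_nuc_minimizer Om' M.
Proof. by move=> /subsetP sub h X feas; apply: h => i j /sub; apply: feas. Qed.

Lemma prob_unif_subset_ge n1 n2 m (P : {set 'I_n1 * 'I_n2} -> Prop) :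
  (0 < n1)%N -> (0 < n2)%N -> (m <= n1 * n2)%N ->
  (forall Om Om' : {set 'I_n1 * 'I_n2}, Om \subset Om' -> P Om -> P Om') ->
  1 - Pr m (fun s => ~ P [set x in s]) <= prob_unif_subset m P.
Proof.
move=> n10 n20 mN mono.
pose phi Om : R := `[< ~ P Om >]%:R.
have anti : antitone phi.
  move=> S S' SS'; rewrite ler_nat; case: asboolP => // h.
  by rewrite asboolT// => /(mono _ _ SS').
have := @subset_avg_le_Ex R _ m phi anti; rewrite card_entries => /(_ mN) h.
rewrite lerBlDr -lerBlDl; apply: le_trans h; rewrite /subset_avg card_entries.
have C0 : (0 : R) < 'C(n1 * n2, m)%:R by rewrite ltr0n bin_gt0.
rewrite ler_pdivlMr// /prob_unif_subset.
set g := #|_|.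
rewrite RdivE !INRE.
rewrite mulrBl mul1r divfK ?gt_eqF//.
have -> : 'C(n1 * n2, m)%:R = \sum_(S : {set 'I_n1 * 'I_n2} | #|S| == m) 1 :> R.
  by rewrite sumr_const -card_entries -card_draws; congr _%:R; apply: eq_card => S; rewrite !inE.
have -> : g%:R = \sum_(S : {set 'I_n1 * 'I_n2} | #|S| == m) `[< P S >]%:R :> R.
  rewrite /g -sumr_const big_mkcond [RHS]big_mkcond; apply: eq_bigr => S _; rewrite inE.
  case: (#|S| == m) => //=; have -> : Defs.asbool (P S) = `[< P S >].
    by rewrite /Defs.asbool; case: ClassicalEpsilon.excluded_middle_informative => h;
      [rewrite asboolT | rewrite asboolF].
  by case: `[< _ >].
rewrite -sumrB; apply: ler_sum => S _; rewrite /phi asbool_neg.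
by case: `[< _ >]; rewrite /= ?subrr ?subr0.
Qed.

End MatrixForm.

(** * Choice of the constants *)

Lemma leq_divn160 m : (320 <= m)%N -> (m <= m %/ 160 * 320)%N.
Proof. lia. Qed.

Section Constants.
(* [a = mu0 r], [x = n^(1/10)], [B = beta ln n], [k = min n1 n2], so that [n1 n2 = n k]. *)
Variables (n k m q p : nat) (a x B w0 : R).
Hypotheses (n_ge2 : (2 <= n)%N) (k_gt0 : (0 < k)%N) (k_le : (k <= n)%N).
Hypotheses (a_ge1 : 1 <= a) (x_ge1 : 1 <= x) (xn : x ^+ 10 = n%:R) (B_ge1 : 1 <= B).
Hypotheses (w0_gt0 : 0 < w0) (m_le : (m <= n * k)%N).
Hypothesis m_ge_a : 10 ^+ 11 * a * n%:R * x ^+ 2 * B <= m%:R.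
Hypothesis m_ge_w : 10 ^+ 11 * w0 ^+ 2 * (n * k)%:R * n%:R * B <= m%:R.
Hypothesis qE : q = (m %/ 160)%N.
Hypotheses (p_ge : 3 * B <= p%:R) (p_le : p%:R <= 4 * B).

Let nR_ge2 : (2 : R) <= n%:R. Proof. by rewrite (ler_nat _ 2). Qed.
Let n0 : (0 : R) < n%:R. Proof. by apply: lt_le_trans nR_ge2. Qed.
Let k0 : (0 : R) < k%:R. Proof. by rewrite ltr0n. Qed.
Let N0 : (0 : R) < (n * k)%:R. Proof. by rewrite natrM mulr_gt0. Qed.
Let x2 : 1 <= x ^+ 2. Proof. exact: exprn_ege1. Qed.
Let B0 : 0 < B. Proof. exact: lt_le_trans B_ge1. Qed.
Let a0 : 0 < a. Proof. exact: lt_le_trans a_ge1. Qed.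

Let nB1 : 1 <= n%:R * B.
Proof. by rewrite (le_trans B_ge1)// ler_peMl ?(ltW B0)// (le_trans _ nR_ge2)// ler1n. Qed.

Let anx : n%:R * B <= a * n%:R * x ^+ 2 * B.
Proof.
rewrite ler_pM2r// -[leLHS]mul1r -[leLHS]mulr1; apply: ler_pM => //; first by rewrite mul1r ltW.
by apply: ler_pM => //; rewrite ltW.
Qed.

Let q_ge : m%:R / 320 <= q%:R :> R.
Proof.
have m320 : (320 <= m)%N.
  rewrite -(ler_nat R); apply: le_trans m_ge_a.
  by have := nB1; have := anx; rewrite -!mulrA; lra.
by rewrite ler_pdivrMr// -natrM ler_nat qE leq_divn160.
Qed.

Lemma batch_size_a : 10 ^+ 8 * a * n%:R * x ^+ 2 * B <= q%:R.
Proof.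
apply: le_trans q_ge; rewrite ler_pdivlMr//; apply: le_trans m_ge_a.
have := anx; by have := nB1; lra.
Qed.

Lemma batch_size_n : 10 ^+ 8 * n%:R * B <= q%:R.
Proof. by apply: le_trans batch_size_a; have := anx; rewrite -!mulrA; lra. Qed.

Lemma q_gt0 : (0 < q)%N.
Proof.
rewrite -(ltr0n R); apply: lt_le_trans batch_size_n.
by rewrite !mulr_gt0.
Qed.

(** [3 * 10^8] exceeds [8 * 81 * 4 * 320^2], the amount that [tau_sqr] consumes; rounding in
    [m %/ 160] loses at most a factor [320] overall, whence [10^11]. *)
Lemma batch_size_w : 3 * 10 ^+ 8 * w0 ^+ 2 * (n * k)%:R * n%:R * B <= q%:R.
Proof.
apply: le_trans q_ge; rewrite ler_pdivlMr//; apply: le_trans m_ge_w.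
have : 0 <= w0 ^+ 2 * (n * k)%:R * n%:R * B.
  by rewrite mulr_ge0 ?(ltW B0)// mulr_ge0// mulr_ge0// sqr_ge0.
lra.
Qed.

(** Since [m] is at most [n k], the lower bound on [m] itself forces [a] to be small against [k]. *)
Lemma rho_le1 : 0 < 2 * a / k%:R <= 1.
Proof.
rewrite divr_gt0 ?mulr_gt0//= ler_pdivrMr// mul1r -(ler_pM2r n0) mulrC.
have mN : m%:R <= n%:R * k%:R :> R by rewrite -natrM ler_nat.
rewrite [k%:R * _]mulrC; apply: le_trans mN; apply: le_trans m_ge_a.
apply: le_trans (_ : 10 ^+ 11 * (a * n%:R) <= _).
  have : 0 <= a * n%:R by rewrite mulr_ge0// ltW.
  by rewrite -!mulrA; lra.
have xB : 1 <= x ^+ 2 * B by rewrite -[1]mulr1; apply: ler_pM.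
have : a * n%:R <= a * n%:R * (x ^+ 2 * B) by rewrite ler_peMr// mulr_ge0// ltW.
lra.
Qed.

Lemma w0_le1 : w0 <= 1.
Proof.
rewrite -(@ler_pXn2r _ 2) ?nnegrE ?(ltW w0_gt0)// expr1n.
have mN : m%:R <= (n * k)%:R :> R by rewrite ler_nat.
have h := le_trans m_ge_w mN.
rewrite -(ler_pM2r N0) mul1r.
have y0 : 0 <= w0 ^+ 2 * (n * k)%:R by rewrite mulr_ge0 ?sqr_ge0.
have : w0 ^+ 2 * (n * k)%:R <= w0 ^+ 2 * (n * k)%:R * (n%:R * B) by rewrite ler_peMr.
lra.
Qed.

(** The slack is spent here: [eps = x^-1] divides the exponent by [x^2], and what remains is
    [q / (16 a n x^2)]. *)
Lemma tail_entry : 4 * B <= x^-1 ^+ 2 * q%:R / (8 * (2 * a / k%:R) * (n * k)%:R).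
Proof.
rewrite ler_pdivlMr ?mulr_gt0 ?invr_gt0 ?mulr_gt0//.
rewrite exprVn mulrC ler_pdivlMl ?(lt_le_trans _ x2)//.
have -> : x ^+ 2 * (8 * (2 * a / k%:R) * (n * k)%:R * (4 * B)) = 64 * (a * n%:R * x ^+ 2 * B).
  by rewrite natrM; field; rewrite gt_eqF.
by apply: le_trans batch_size_a; have := anx; have := nB1; lra.
Qed.

Lemma moment_order : 2 * p%:R <= q%:R * k%:R^-1 :> R.
Proof.
rewrite ler_pdivlMr//; apply: le_trans batch_size_n.
apply: le_trans (_ : 2 * (4 * B) * n%:R <= _).
  apply: ler_pM => //; first by rewrite mulr_ge0.
    by rewrite ler_pM2l.
  by rewrite ler_nat.
by have := nB1; lra.
Qed.

(** Chosen so that the operator errors of the 160 batches add up to exactly one half ([tau_op]). *)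
Let tau := q%:R / (320 * (n * k)%:R * w0).

Lemma tau_gt0 : 0 < tau.
Proof. by rewrite divr_gt0 ?ltr0n ?q_gt0// !mulr_gt0. Qed.

Lemma tau_op : 160%:R * ((n * k)%:R / q%:R * w0 * tau) <= 2^-1.
Proof.
have q0 : q%:R != 0 :> R by rewrite pnatr_eq0 -lt0n q_gt0.
rewrite le_eqVlt; apply/orP; left; apply/eqP; rewrite /tau natrM.
by field; rewrite q0 gt_eqF//= !gt_eqF.
Qed.

Lemma tau_sqr : 8 * exp 4 * p%:R * (q%:R * k%:R^-1) <= tau ^+ 2.
Proof.
have q0 : (0 : R) < q%:R by rewrite ltr0n q_gt0.
apply: le_trans (_ : 8 * 81 * (4 * B) * (q%:R * k%:R^-1) <= _).
  rewrite ler_wpM2r ?mulr_ge0 ?invr_ge0//; apply: ler_pM => //.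
    by rewrite mulr_ge0// ltW// exp_gt0.
  by rewrite ler_wpM2l// exp_nat4.
rewrite /tau expr_div_n ler_pdivlMr; last by rewrite exprn_gt0// !mulr_gt0.
have -> : 8 * 81 * (4 * B) * (q%:R / k%:R) * (320 * (n * k)%:R * w0) ^+ 2 =
   2592 * 320 ^+ 2 * (w0 ^+ 2 * (n * k)%:R * n%:R * B) * q%:R.
  by rewrite natrM; field; rewrite gt_eqF.
rewrite [q%:R ^+ 2]expr2 ler_pM2r//; apply: le_trans batch_size_w.
have : 0 <= w0 ^+ 2 * (n * k)%:R * n%:R * B.
  by rewrite mulr_ge0 ?(ltW B0)// mulr_ge0// mulr_ge0// sqr_ge0.
lra.
Qed.

Let eps160 : x^-1 ^+ 160 = (n%:R ^+ 16)^-1.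
Proof. by rewrite -xn -exprM exprVn. Qed.

Let NE : (n * k)%:R <= n%:R ^+ 2 :> R.
Proof. by rewrite -natrX ler_nat -mulnn leq_mul2l k_le orbT. Qed.

(** 160 contractions give [n^(-16)] against [640 n^5]; the remaining [n^11] is at least
    [2^11 > 640]. *)
Lemma eps_final : 4 * 160%:R * n%:R * (n * k)%:R ^+ 2 * x^-1 ^+ 160 < 1.
Proof.
rewrite eps160 ltr_pdivrMr ?exprn_gt0// mul1r.
apply: le_lt_trans (_ : 640 * n%:R ^+ 5 < _).
  have -> : 640 * n%:R ^+ 5 = 4 * 160%:R * n%:R * (n%:R ^+ 2) ^+ 2 :> R by ring.
  by rewrite ler_wpM2l ?mulr_ge0// lerXn2r// nnegrE ?exprn_ge0.
rewrite -[16%N]/(11 + 5)%N exprD ltr_pM2r ?exprn_gt0//.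
apply: lt_le_trans (_ : 2 ^+ 11 <= _); first by lra.
by apply: lerXn2r; rewrite ?nnegrE.
Qed.

Lemma eps_residual : (n * k)%:R * x^-1 ^+ 160 <= 2^-1.
Proof.
rewrite eps160 ler_pdivrMr ?exprn_gt0//; apply: le_trans NE _.
rewrite -[16%N]/(14 + 2)%N exprD mulrA -[leLHS]mul1r ler_pM2r ?exprn_gt0//.
apply: le_trans (_ : 2^-1 * 2 ^+ 14 <= _); first by lra.
rewrite ler_pM2l ?invr_gt0//; apply: lerXn2r; rewrite ?nnegrE//.
Qed.

(** At most [2 n^2] starts, 160 batches each, every batch failing with probability at most
    [2 n^2 e^4 + 2 n e^3] for [e = exp (- B)]. As [n^2 e <= 1], both products are at most
    [640 e]. *)
Lemma failure_total n1 n2 : (n1 + n2 <= 2 * n)%N -> (n1 * n2 = n * k)%N ->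
  n%:R ^+ 2 <= exp B ->
  (n1 * n2).+1%:R * (160%:R * batch_fail n1 n2 (2 * a / k%:R) q p x^-1) <= 1280 * exp (- B).
Proof.
move=> n12 n12E nB; rewrite /batch_fail n12E.
have e0 := exp_gt0 (- B).
have eA : exp (- (x^-1 ^+ 2 * q%:R / (8 * (2 * a / k%:R) * (n * k)%:R))) <= exp (- B) ^+ 4.
  by rewrite -exp_natM mulrN ler_exp// lerN2 tail_entry.
have ep : exp (- p%:R) <= exp (- B) ^+ 3.
  by rewrite -exp_natM mulrN ler_exp// lerN2.
have nB' : n%:R ^+ 2 * exp (- B) <= 1.
  by rewrite expN ler_pdivrMr ?exp_gt0// mul1r.
have e1 : exp (- B) <= 1 by rewrite -expr0E ler_exp// oppr_le0 ltW.
have N1 : (n * k).+1%:R <= 2 * n%:R ^+ 2 :> R.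
  have : 1 <= n%:R ^+ 2 :> R by rewrite exprn_ege1// (le_trans _ nR_ge2)// ler1n.
  by rewrite -natr1; have := NE; lra.
have s12 : (n1 + n2)%:R <= 2 * n%:R :> R by rewrite -natrM ler_nat.
set e := exp (- B) in e0 eA ep nB' e1 *; pose y : R := n%:R.
have y2 : 2 <= y by exact: nR_ge2.
have y0 : 0 < y by exact: n0.
have NEy : (n * k)%:R <= y ^+ 2 by exact: NE.
rewrite -/y in nB' N1 s12.
have inner_le : (n * k)%:R * (2 * exp (- (x^-1 ^+ 2 * q%:R / (8 * (2 * a / k%:R) * (n * k)%:R)))) +
    (n1 + n2)%:R * exp (- p%:R) <= y ^+ 2 * (2 * e ^+ 4) + 2 * y * e ^+ 3.
  apply: lerD; apply: ler_pM => //; rewrite ?mulr_ge0 ?(ltW (exp_gt0 _))//.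
  by rewrite ler_pM2l.
apply: le_trans (_ : 2 * y ^+ 2 * (160%:R * (y ^+ 2 * (2 * e ^+ 4) + 2 * y * e ^+ 3)) <= _).
  apply: ler_pM => //; last by rewrite ler_pM2l.
  by rewrite mulr_ge0// addr_ge0// !mulr_ge0// ltW// exp_gt0.
set t := y ^+ 2 * e in nB'.
have t0 : 0 <= t by rewrite mulr_ge0 ?exprn_ge0// ltW.
have -> : 2 * y ^+ 2 * (160%:R * (y ^+ 2 * (2 * e ^+ 4) + 2 * y * e ^+ 3)) =
  640 * (t ^+ 2 * e ^+ 2) + 640 * (t * y * e * e) by rewrite /t; ring.
have h1 : t ^+ 2 * e ^+ 2 <= e.
  rewrite -[leRHS]mul1r; apply: ler_pM; rewrite ?exprn_ge0//; first exact: ltW.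
    by rewrite exprn_ile1.
  by rewrite expr2 ler_piMl// ltW.
have h2 : t * y * e * e <= e.
  rewrite ler_piMl//; first exact: ltW.
  apply: le_trans (_ : t * t <= _).
    rewrite -mulrA ler_wpM2l// ler_wpM2r ?(ltW e0)// -[leLHS]mulr1 expr2 ler_pM2l//.
    by lra.
  by rewrite -expr2 exprn_ile1.
lra.
Qed.

End Constants.

(** * Recovery probability from entrywise bounds *)

Section Completion.
Variables (n1 n2 r m : nat) (s : 'I_r -> R) (u : 'I_r -> vec n1) (v : 'I_r -> vec n2).
Variables (mu0 x B w0 : R).
Let n := maxn n1 n2.
Let U := basis_mx u.
Let V := basis_mx v.
Hypotheses (n1_gt0 : (0 < n1)%N) (n2_gt0 : (0 < n2)%N) (n_ge2 : (2 <= n)%N).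
Hypotheses (s_gt0 : forall k, 0 < s k) (u_ortho : orthonormal u) (v_ortho : orthonormal v).
Hypotheses (hU : forall i, (U *m U^T) i i <= mu0 * r%:R / n1%:R)
  (hV : forall j, (V *m V^T) j j <= mu0 * r%:R / n2%:R).
Hypotheses (a_ge1 : 1 <= mu0 * r%:R) (x_ge1 : 1 <= x) (xn : x ^+ 10 = n%:R) (B_ge1 : 1 <= B)
  (nB : n%:R ^+ 2 <= exp B).
Hypotheses (w0_gt0 : 0 < w0) (UVw : forall i j, `|(U *m V^T) i j| <= w0)
  (m_le : (m <= n1 * n2)%N).
Hypothesis m_ge_a : 10 ^+ 11 * (mu0 * r%:R) * n%:R * x ^+ 2 * B <= m%:R.
Hypothesis m_ge_w : 10 ^+ 11 * w0 ^+ 2 * (n1 * n2)%:R * n%:R * B <= m%:R.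

Lemma completion_probability :
  1 - 1280 * exp (- B) <= prob_unif_subset m (fun Om => unique_nuc_minimizer Om (svd_mat s u v)).
Proof.
pose k := minn n1 n2; pose q := (m %/ 160)%N.
have NE : (n1 * n2 = n * k)%N by rewrite /n /k; case: (leqP n1 n2) => _; rewrite // mulnC.
have k0 : (0 < k)%N by rewrite leq_min n1_gt0.
have kn : (k <= n)%N by rewrite geq_min leq_maxl.
have B0 : 0 <= 3 * B by rewrite mulr_ge0// (le_trans _ B_ge1).
(* The lower bound [3 B] yields the tail [exp (- 3 B)]; [B >= 1] leaves room for rounding up. *)
have [p p_ge p_le] : exists2 p : nat, 3 * B <= p%:R & p%:R <= 4 * B.
  have /andP[h1 h2] := truncn_itv B0.
  exists (Num.truncn (3 * B)).+1; first exact: ltW.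
  rewrite -natr1; apply: le_trans (_ : 3 * B + 1 <= _); first by rewrite lerD2r.
  have -> : 4 * B = 3 * B + B by ring.
  by rewrite lerD2l.
have p0 : (0 < p)%N.
  by rewrite -(ltr0n R); apply: lt_le_trans p_ge; rewrite mulr_gt0// (lt_le_trans _ B_ge1).
have mw : 10 ^+ 11 * w0 ^+ 2 * (n * k)%:R * n%:R * B <= m%:R by rewrite -NE.
have mN : (m <= n * k)%N by rewrite -NE.
have x0 : 0 < x by apply: lt_le_trans x_ge1.
pose a := mu0 * r%:R; have a0 : 0 <= a by apply: le_trans a_ge1.
have k0R : (0 : R) < k%:R by rewrite ltr0n.
have rho_half : 2 * a / k%:R / 2 = a / k%:R by rewrite mulrAC [2 * a]mulrC mulfK ?pnatr_eq0.
have qd : q = (m %/ 160)%N by [].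
have q0 := q_gt0 n_ge2 a_ge1 x_ge1 B_ge1 m_ge_a qd.
have kap i : (k <= i)%N -> (0 < i)%N -> (i%:R)^-1 <= (k%:R)^-1 :> R.
  by move=> ki i0; rewrite lef_pV2 ?posrE ?ltr0n// ler_nat.
have bound := @Pr_dual_certifiable n1 n2 r U V 160 q p n (2 * a / k%:R) x^-1
  (q%:R / (320 * (n * k)%:R * w0)) k%:R^-1 w0.
rewrite NE in bound.
have {bound} bound : Pr (160 * q) (fun s => ~ dual_certifiable U V (fun a => a \in s)) <=
    (n1 * n2).+1%:R * (160%:R * batch_fail n1 n2 (2 * a / k%:R) q p x^-1).
  rewrite NE; apply: bound => //.
  - by rewrite n1_gt0 leq_maxl.
  - by rewrite n2_gt0 leq_maxr.
  - exact: basis_mx_ortho.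
  - exact: basis_mx_ortho.
  - exact: (rho_le1 n_ge2 k0 a_ge1 x_ge1 B_ge1 mN m_ge_a).
  - move=> i; rewrite rho_half; apply: le_trans (hU i) _.
    by rewrite ler_wpM2l// kap ?geq_minl.
  - move=> j; rewrite rho_half; apply: le_trans (hV j) _.
    by rewrite ler_wpM2l// kap ?geq_minr.
  - by rewrite w0_gt0 (w0_le1 n_ge2 k0 B_ge1 w0_gt0 mN mw).
  - by rewrite invr_gt0 x0 invf_le1.
  - exact: tau_gt0 n_ge2 k0 a_ge1 x_ge1 B_ge1 w0_gt0 m_ge_a qd.
  - by rewrite kap ?geq_minl.
  - by rewrite kap ?geq_minr.
  - exact: moment_order n_ge2 k0 kn a_ge1 x_ge1 B_ge1 m_ge_a qd p_le.
  - exact: tau_sqr n_ge2 k0 a_ge1 x_ge1 B_ge1 w0_gt0 m_ge_a mw qd p_le.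
  - exact: tau_op n_ge2 k0 a_ge1 x_ge1 B_ge1 w0_gt0 m_ge_a qd.
  - exact: eps_final n_ge2 kn xn.
  - exact: eps_residual n_ge2 kn xn.
have total := @failure_total n k m q p a x B n_ge2 k0 kn a_ge1 x_ge1 B_ge1 m_ge_a qd p_ge n1 n2.
have n12 : (n1 + n2 <= 2 * n)%N.
  by rewrite mul2n -addnn leq_add ?leq_maxl ?leq_maxr.
have {bound total} bound := le_trans bound (total n12 NE nB).
apply: le_trans (prob_unif_subset_ge n1_gt0 n2_gt0 m_le _); last first.
  by move=> Om Om'; apply: unique_nuc_minimizer_sub.
rewrite lerD2l lerN2; apply: le_trans bound.
(* The draws left over after 160 full batches only enlarge the sample, which preserves
   certifiability. *)
have mE : m = (160 * q + (m - 160 * q))%N by rewrite subnKC// mulnC leq_divM.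
rewrite mE -[leRHS]addr0; apply: Pr_cat => //; first exact: entries_gt0.
move=> s1 sz /contrapT dual.
rewrite -(Ex_cst (R := R) (entries_gt0 n1_gt0 n2_gt0) (m - 160 * q) 0); apply: le_Ex => s2 _.
rewrite lern0 eqb0; apply/asboolPn; apply.
apply: dual_certifiable_unique => // Z Zs; apply: dual => i j ij; apply: Zs.
by rewrite inE mem_cat ij.
Qed.

End Completion.

(** * Coherence, and fractional powers of [n] *)

Lemma le_bigRmax d (F : 'I_d -> R) i : F i <= \big[Rmax/0]_(j < d) F j.
Proof.
have -> : \big[Rmax/0]_(j < d) F j = \big[Num.max/0]_(j < d) F j.
  by elim/big_ind2: _ => // x1 x2 y1 y2 -> ->; rewrite RmaxE.
exact: le_bigmax.
Qed.

(** For a symmetric idempotent [P], the squared norm of [P e_i] is the diagonal entry [P i i]. *)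
Lemma coherence_diag d r (w : 'I_r -> vec d) (mu0 : R) i : orthonormal w -> (0 < r)%N ->
  coherence w <= mu0 ->
  (basis_mx w *m (basis_mx w)^T) i i <= mu0 * r%:R / d%:R.
Proof.
move=> wo r0; rewrite /coherence RmultE RdivE !INRE => h.
have d0 : (0 < d)%N by case: d i {h wo w} => // -[].
have dR : (0 : R) < d%:R by rewrite ltr0n.
have rR : (0 : R) < r%:R by rewrite ltr0n.
pose P := basis_mx w *m (basis_mx w)^T.
have projE j : proj w (ebasis i) j = P i j.
  rewrite mxE; apply: eq_bigr => k _; rewrite !mxE; congr (_ * _).
  rewrite /dot (bigD1 i)//= big1.
    by rewrite /ebasis eqxx RplusE RmultE addr0 mulr1.
  by move=> l /negPf li; rewrite /ebasis li RmultE mulr0.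
have PP : P *m P = P.
  by rewrite /P mulmxA -(mulmxA (basis_mx w)) basis_mx_ortho// mulmx1.
have Ps : P^T = P by rewrite trmx_mul trmxK.
have E : sqnorm (proj w (ebasis i)) = P i i.
  rewrite -[in RHS]PP [RHS]mxE; apply: eq_bigr => j _; rewrite projE; congr (_ * _).
  by rewrite -[in RHS]Ps [RHS]mxE.
rewrite ler_pdivlMr// -/P -E.
apply: le_trans (_ : (\big[Rmax/0]_(i < d) sqnorm (proj w (ebasis i))) * d%:R <= _).
  by rewrite ler_wpM2r// (le_bigRmax (fun i => sqnorm (proj w (ebasis i)))).
set b := \big[Rmax/0]_(_ < _) _ in h *; rewrite -(ler_pM2r rR) in h; apply: le_trans h.
by rewrite [d%:R / r%:R * b]mulrAC divfK ?gt_eqF// mulrC.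
Qed.

(** The projection has trace [r], so its diagonal entries average [r / d]. *)
Lemma coherence_ge1 d r (w : 'I_r -> vec d) (mu0 : R) : orthonormal w -> (0 < r)%N ->
  coherence w <= mu0 -> 1 <= mu0.
Proof.
move=> wo r0 h; have rR : (0 : R) < r%:R by rewrite ltr0n.
have trE : \sum_i (basis_mx w *m (basis_mx w)^T) i i = r%:R.
  by rewrite -/(mxtrace _) mxtrace_mulC basis_mx_ortho// mxtrace1.
have le_tr : r%:R <= \sum_(i < d) mu0 * r%:R / d%:R.
  by rewrite -[leLHS]trE; apply: ler_sum => i _; apply: coherence_diag.
have d0 : (0 < d)%N.
  by rewrite lt0n; apply: contraTneq le_tr => d0; subst d; rewrite big_ord0 -ltNge.
have dR : d%:R != 0 :> R by rewrite pnatr_eq0 -lt0n.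
by move: le_tr; rewrite sumr_const card_ord -[_ *+ d]mulr_natr divfK// -[leLHS]mul1r ler_pM2r.
Qed.

Section Logarithm.

Lemma ln_ge1D (y : R) : 0 < y -> 1 - y^-1 <= ln y.
Proof.
move=> y0; have := exp_ge1D (- ln y).
rewrite expN exp_ln; last exact/RltP.
lra.
Qed.

Lemma exp_lnE (y : R) : 0 < y -> exp (ln y) = y.
Proof. by move=> y0; apply: exp_ln; apply/RltP. Qed.

Variable n : nat.
Hypothesis n_ge2 : (2 <= n)%N.
Let root10 : R := exp (ln n%:R / 10).

Let nR_gt0 : (0 : R) < n%:R.
Proof. by rewrite ltr0n (leq_trans _ n_ge2). Qed.

Lemma ln_nat_ge : 2^-1 <= ln n%:R :> R.
Proof.
apply: le_trans (ln_ge1D nR_gt0).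
have : (n%:R)^-1 <= 2^-1 :> R by rewrite lef_pV2 ?posrE// ler_nat.
lra.
Qed.

Let lnn_ge0 : 0 <= ln n%:R :> R.
Proof. by apply: le_trans ln_nat_ge; rewrite invr_ge0. Qed.

Lemma root10_ge1 : 1 <= root10.
Proof. by rewrite -expr0E ler_exp// divr_ge0. Qed.

Lemma root10_pow : root10 ^+ 10 = n%:R.
Proof.
rewrite -exp_natM mulrC divfK ?exp_lnE//.
by rewrite pnatr_eq0.
Qed.

Lemma Rpower_fifth : Rpower (INR n) (1 / 5)%coqR = root10 ^+ 2.
Proof.
rewrite INRE /Rpower /root10 -exp_natM; congr exp.
have -> : (1 / 5)%coqR = 5^-1 :> R by rewrite RdivE !IZRposE !INRE div1r.
by rewrite RmultE; field.
Qed.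

Lemma Rpower_six_fifth : Rpower (INR n) (6 / 5)%coqR = n%:R * root10 ^+ 2.
Proof.
rewrite INRE /Rpower -[X in X * _](exp_lnE nR_gt0) /root10 -exp_natM -expD; congr exp.
have -> : (6 / 5)%coqR = 6 / 5 :> R by rewrite RdivE !IZRposE !INRE.
by rewrite RmultE; field.
Qed.

Lemma Rpower_fourth_ge : root10 ^+ 2 <= Rpower (INR n) (1 / 4)%coqR.
Proof.
rewrite INRE /Rpower /root10 -exp_natM; apply: ler_exp.
have -> : (1 / 4)%coqR = 4^-1 :> R by rewrite RdivE !IZRposE !INRE div1r.
by rewrite RmultE; have := lnn_ge0; lra.
Qed.

End Logarithm.

Lemma svd_entry_le n1 n2 r (u : 'I_r -> vec n1) (v : 'I_r -> vec n2) (mu0 : R) :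
  orthonormal u -> orthonormal v -> (0 < r)%N -> 0 <= mu0 ->
  coherence u <= mu0 -> coherence v <= mu0 -> forall i j,
  `|(basis_mx u *m (basis_mx v)^T) i j| <= mu0 * r%:R / Num.sqrt (n1 * n2)%:R.
Proof.
move=> uo vo r0 mu00 cu cv i j.
have hU := coherence_diag i uo r0 cu; have hV := coherence_diag j vo r0 cv.
have b0 : 0 <= mu0 * r%:R / Num.sqrt (n1 * n2)%:R by rewrite divr_ge0 ?mulr_ge0 ?sqrtr_ge0.
rewrite -(@ler_pXn2r _ 2) ?nnegrE// real_normK ?num_real//.
rewrite expr_div_n sqr_sqrtr// natrM.
have -> : (mu0 * r%:R) ^+ 2 / (n1%:R * n2%:R) =
  (mu0 * r%:R / n1%:R) * (mu0 * r%:R / n2%:R) by rewrite expr2 invfM mulrACA.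
have diagE d (w : 'I_r -> vec d) l : (basis_mx w *m (basis_mx w)^T) l l = \sum_k w k l ^+ 2.
  by rewrite mxE; apply: eq_bigr => k _; rewrite !mxE expr2.
rewrite diagE in hU; rewrite diagE in hV.
apply: le_trans (_ : (\sum_k u k i ^+ 2) * (\sum_k v k j ^+ 2) <= _).
  by rewrite mxE; under eq_bigr do rewrite !mxE; apply: CauchySchwarz_sum.
by apply: ler_pM => //; apply: sumr_ge0 => k _; rewrite sqr_ge0.
Qed.

Lemma prob_unif_subset_ge0 n1 n2 m P : 0 <= @prob_unif_subset n1 n2 m P.
Proof. by rewrite /prob_unif_subset RdivE !INRE divr_ge0. Qed.

Lemma prob_unif_subset_total n1 n2 m (P : {set 'I_n1 * 'I_n2} -> Prop) :
  (m <= n1 * n2)%N -> (forall Om, P Om) -> prob_unif_subset m P = 1.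
Proof.
move=> mN PT; rewrite /prob_unif_subset RdivE !INRE.
have -> : #|[set Om : {set 'I_n1 * 'I_n2} | (#|Om| == m) && Defs.asbool (P Om)]| = 'C(n1 * n2, m).
  rewrite -card_entries -card_draws; apply: eq_card => Om; rewrite !inE /Defs.asbool.
  case: ClassicalEpsilon.excluded_middle_informative => [h|/(_ (PT Om))//].
  by rewrite andbT.
by rewrite divff// pnatr_eq0 -lt0n bin_gt0.
Qed.

(** * The two regimes *)

Section Main.
Variables (n1 n2 r m : nat) (s : 'I_r -> R) (u : 'I_r -> vec n1) (v : 'I_r -> vec n2).
Variables (mu0 mu1 beta : R).
Let n := maxn n1 n2.
Let M := svd_mat s u v.
Let prob := prob_unif_subset m (fun Om => unique_nuc_minimizer Om M).
Hypotheses (r_gt0 : (0 < r)%N) (s_gt0 : forall k, 0 < s k).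
Hypotheses (u_ortho : orthonormal u) (v_ortho : orthonormal v).
Hypotheses (mu0_gt0 : 0 < mu0) (mu1_ge1 : 1 <= mu1).
Hypotheses (cu : coherence u <= mu0) (cv : coherence v <= mu0).
Hypothesis A1 : forall i j, `|svd_mat (fun _ => 1) u v i j| <= mu1 * sqrt (r%:R / (n1%:R * n2%:R)).
Hypotheses (m_le : (m <= n1 * n2)%N) (beta_gt2 : 2 < beta).

Let ortho_dim d (w : 'I_r -> vec d) : orthonormal w -> (0 < d)%N.
Proof.
move=> wo; case: d w wo => // w wo; have := wo (Ordinal r_gt0) (Ordinal r_gt0).
by rewrite /dot big_ord0 eqxx => h; have := oner_neq0 R; rewrite -[1]h eqxx.
Qed.

Lemma completion_large (w0 : R) : (2 <= n)%N -> 0 < w0 ->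
  (forall i j, `|(basis_mx u *m (basis_mx v)^T) i j| <= w0) ->
  10 ^+ 11 * (mu0 * r%:R) * n%:R * exp (ln n%:R / 10) ^+ 2 * (beta * ln n%:R) <= m%:R ->
  10 ^+ 11 * w0 ^+ 2 * (n1 * n2)%:R * n%:R * (beta * ln n%:R) <= m%:R ->
  1 - 1280 * exp (- (beta * ln n%:R)) <= prob.
Proof.
move=> n2' w00 UVw h1 h2.
have n10 := ortho_dim u_ortho; have n20 := ortho_dim v_ortho.
have lnn := ln_nat_ge n2'.
have b2 : 2 * ln n%:R <= beta * ln n%:R.
  by rewrite ler_wpM2r ?(ltW beta_gt2)// (le_trans _ lnn)// invr_ge0.
apply: (completion_probability n10 n20 n2' s_gt0 u_ortho v_ortho (mu0 := mu0)
  (x := exp (ln n%:R / 10)) (w0 := w0)) => //.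
- by move=> i; apply: coherence_diag.
- by move=> j; apply: coherence_diag.
- have mu01 := coherence_ge1 u_ortho r_gt0 cu.
  by apply: le_trans mu01 _; rewrite ler_peMr ?ler1n// ltW.
- exact: root10_ge1.
- exact: root10_pow.
- by apply: le_trans b2; rewrite mulrC -ler_pdivrMr// div1r.
- apply: le_trans (ler_exp b2); rewrite exp_natM exp_lnE//.
  by rewrite ltr0n (leq_trans _ n2').
Qed.

Let NR_gt0 : (0 : R) < (n1 * n2)%:R.
Proof. by rewrite ltr0n muln_gt0 (ortho_dim u_ortho) (ortho_dim v_ortho). Qed.

(** At [n = 1] the logarithm vanishes and the claimed lower bound is [1 - 1280], which is
    negative. *)
Let n_small : (n < 2)%N -> 1 - 1280 * exp (- (beta * ln n%:R)) <= prob.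
Proof.
move=> n1'; have -> : n = 1%N.
  by apply/eqP; rewrite eqn_leq -ltnS n1' /n leq_max (ortho_dim u_ortho).
rewrite (_ : ln 1%:R = 0); last exact: ln_1.
rewrite mulr0 oppr0 expr0E; apply: le_trans (prob_unif_subset_ge0 _ _); lra.
Qed.

Lemma completion_incoherent :
  10 ^+ 11 * Num.max (Num.max (mu1 ^+ 2) (sqrt mu0 * mu1)) (mu0 * Rpower (INR n) (1 / 4)%coqR)
     * n%:R * r%:R * (beta * ln n%:R) <= m%:R ->
  1 - 1280 * exp (- (beta * ln n%:R)) <= prob.
Proof.
move=> hm; have [/n_small//|n2'] := ltnP n 2.
have lnn : 0 <= ln n%:R :> R by apply: le_trans (ln_nat_ge n2'); rewrite invr_ge0.
have c0 : 0 <= n%:R * r%:R * (beta * ln n%:R).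
  by rewrite !mulr_ge0// (le_trans _ (ltW beta_gt2)).
have rR : (0 : R) < r%:R by rewrite ltr0n.
pose w0 := mu1 * Num.sqrt (r%:R / (n1 * n2)%:R).
have w0N : w0 ^+ 2 * (n1 * n2)%:R = mu1 ^+ 2 * r%:R.
  rewrite /w0 exprMn sqr_sqrtr ?divr_ge0// -mulrA divfK// gt_eqF//.
set K := Num.max _ _ in hm.
have K1 : mu1 ^+ 2 <= K by rewrite !le_max lexx.
have K2 : mu0 * exp (ln n%:R / 10) ^+ 2 <= K.
  by rewrite le_max ler_wpM2l ?orbT ?(ltW mu0_gt0)// Rpower_fourth_ge.
apply: (@completion_large w0) => //.
- by rewrite mulr_gt0 ?sqrtr_gt0 ?divr_gt0// (lt_le_trans _ mu1_ge1).
- move=> i j; have := A1 i j; rewrite RsqrtE -natrM => h; apply: le_trans h.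
  rewrite le_eqVlt; apply/orP; left; apply/eqP; congr (`|_|).
  by rewrite mxE; apply: eq_bigr => k _; rewrite !mxE RmultE RmultE mul1r.
- by apply: le_trans hm; have := ler_wpM2r c0 K2; lra.
- by apply: le_trans hm; have := ler_wpM2r c0 K1; rewrite -(mulrA _ (w0 ^+ 2)) w0N; lra.
Qed.

Lemma completion_low_rank :
  r%:R <= mu0^-1 * Rpower (INR n) (1 / 5)%coqR ->
  10 ^+ 11 * mu0 * Rpower (INR n) (6 / 5)%coqR * r%:R * (beta * ln n%:R) <= m%:R ->
  1 - 1280 * exp (- (beta * ln n%:R)) <= prob.
Proof.
have [/n_small//|n2'] := ltnP n 2.
rewrite Rpower_fifth Rpower_six_fifth// ler_pdivlMl// => hr hm.
have lnn : 0 <= ln n%:R :> R by apply: le_trans (ln_nat_ge n2'); rewrite invr_ge0.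
have rR : (0 : R) < r%:R by rewrite ltr0n.
set y := exp _ ^+ 2 in hr hm.
have c0 : 0 <= mu0 * r%:R * (n%:R * (beta * ln n%:R)).
  apply: mulr_ge0; first by rewrite mulr_ge0// ltW.
  by rewrite mulr_ge0// mulr_ge0// (le_trans _ (ltW beta_gt2)).
(* Now [w0^2 n1 n2] is [(mu0 r)^2], and the rank hypothesis trades one factor [mu0 r] for
   [n^(1/5)]. *)
pose w0 := mu0 * r%:R / Num.sqrt (n1 * n2)%:R.
have w0N : w0 ^+ 2 * (n1 * n2)%:R = (mu0 * r%:R) ^+ 2.
  by rewrite /w0 expr_div_n sqr_sqrtr ?(ltW NR_gt0)// divfK// gt_eqF.
apply: (@completion_large w0) => //.
- by rewrite divr_gt0 ?mulr_gt0// sqrtr_gt0.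
- exact: svd_entry_le u_ortho v_ortho r_gt0 (ltW mu0_gt0) cu cv.
- by apply: le_trans hm; rewrite -/y; lra.
- by apply: le_trans hm; have := ler_wpM2r c0 hr; rewrite -(mulrA _ (w0 ^+ 2)) w0N; lra.
Qed.

End Main.

Delimit Scope R_scope with R.
Bind Scope R_scope with R.
Local Close Scope ring_scope.

Theorem theorem1p2 :
  exists C c : R,
  forall (n1 n2 r : nat) (s : 'I_r -> R) (u : 'I_r -> vec n1) (v : 'I_r -> vec n2)
         (mu0 mu1 beta : R) (m : nat),
  let M := svd_mat s u v in
  let n := maxn n1 n2 in
  (forall k, 0 < s k)%R -> orthonormal u -> orthonormal v ->
  (0 < mu0)%R -> (1 <= mu1)%R ->
  (* A0 *)
  (Rmax (coherence u) (coherence v) <= mu0)%R ->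
  (* A1 *)
  (forall i j, Rabs (svd_mat (fun _ => 1%R) u v i j)
                 <= mu1 * sqrt (INR r / (INR n1 * INR n2)))%R ->
  (m <= n1 * n2)%N ->
  (2 < beta)%R ->
  ((INR m >= C * Rmax (Rmax (mu1 ^ 2) (sqrt mu0 * mu1))
                        (mu0 * Rpower (INR n) (1 / 4))
             * INR n * INR r * (beta * ln (INR n)))%R ->
   (prob_unif_subset m (fun Om => unique_nuc_minimizer Om M)
      >= 1 - c * Rpower (INR n) (- beta))%R)
  /\
  ((INR r <= / mu0 * Rpower (INR n) (1 / 5))%R ->
   (INR m >= C * mu0 * Rpower (INR n) (6 / 5) * INR r * (beta * ln (INR n)))%R ->
   (prob_unif_subset m (fun Om => unique_nuc_minimizer Om M)
      >= 1 - c * Rpower (INR n) (- beta))%R).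
Proof.
Local Open Scope ring_scope.
Bind Scope ring_scope with R.
exists (10 ^+ 11 : R), (1280 : R).
move=> n1 n2 r s u v mu0 mu1 beta m M n s0 uo vo mu0_gt0 mu1_ge1 A0 A1 mN beta2.
set prob := prob_unif_subset _ _.
have concl : 1 - 1280 * exp (- (beta * ln n%:R)) <= prob ->
    Rge prob (Rminus 1%:R (Rmult 1280%:R (Rpower (INR n) (Ropp beta)))).
  move=> h; apply: Rle_ge; apply/RleP; rewrite INRE /Rpower.
  by rewrite [Rmult (Ropp _) _]RmultE RoppE mulNr.
have [r0|r_gt0] := posnP r.
  suff h : 1 - 1280 * exp (- (beta * ln n%:R)) <= prob by split=> *; apply: concl.
  rewrite /prob prob_unif_subset_total//; last by move=> Om; subst r; apply: unique_rank0.
  by rewrite gerBl mulr_ge0// ltW// exp_gt0.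
have cu : coherence u <= mu0 by apply/RleP/(Rle_trans _ _ _ (Rmax_l _ _) A0).
have cv : coherence v <= mu0 by apply/RleP/(Rle_trans _ _ _ (Rmax_r _ _) A0).
have A1' i j : `|svd_mat (fun=> 1) u v i j| <= mu1 * sqrt (r%:R / (n1%:R * n2%:R)).
  by have /RleP := A1 i j; rewrite !INRE.
have s_gt0 k : 0 < s k by apply/RltP.
move/RltP: mu0_gt0 => mu0_gt0; move/RleP: mu1_ge1 => mu1_ge1; move/RltP: beta2 => beta2.
split=> [/Rge_le/RleP hm|/RleP hr /Rge_le/RleP hm]; apply: concl.
- apply: (completion_incoherent r_gt0 s_gt0 uo vo mu0_gt0 mu1_ge1 cu cv A1' mN beta2).
  by move: hm; rewrite !INRE !RmaxE RpowE.
- apply: (completion_low_rank r_gt0 s_gt0 uo vo mu0_gt0 cu cv mN beta2).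
  + by move: hr; rewrite INRE.
  + by move: hm; rewrite !INRE.
Qed.
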